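(* Suppose the network, problem and stochastic-gradient assumptions listed in the context hold, and let the iterates $\mathbf y_n^r,\mathbf v_n^r$ be generated by the LSGT algorithm described in the context with step size $\gamma>0$, $E\ge 1$ local updates per round. Let the step size $\gamma<1$ be so small that all of the following hold (write $\lambda=\lambda_w$): (i) $\gamma\le \frac{\lambda^2}{32ENL}$; (ii) $\gamma\le \frac{(1-\lambda^2)^2}{32L^2(1+7\lambda^2)\,[8(1+16\lambda^2)(E-1)^2]}$ (no restriction if $E=1$); (iii) $\gamma\le\frac{1-\lambda^2}{3600ENL}$; (iv) there exist $s_1,s_2>0$ with $s_1<\frac{(1-\lambda^2)^2}{40(1+7\lambda^2)(1+\lambda^2)L^2}s_2$ such that $\gamma\le\frac{3(1-\lambda^2)s_1}{16(1+7\lambda^2)[1+8(E-1)\lambda]s_2}$; (v) $\gamma\le\frac{3(1-\lambda^2)^2}{320(1+7\lambda^2)(1+\lambda^2)[1+8(E-1)\lambda]NL}$; (vi) $\gamma\le\frac{1}{62E(1+\lambda^2)NL}$; (vii) $\gamma\le\frac{1-\lambda^2}{320E^2NL}$. Then $$\frac1T\sum_{r=0}^{T-1}\mathbb E\Big[\Big\|\frac1N\sum_{n=1}^N\nabla f_n(\mathbf y_n^r)\Big\|^2\Big]\le \frac{4(F(\bar{\mathbf y}^0)-\underline F)}{\gamma ET}+\frac{40L\gamma\sigma^2}{N|\mathcal I|}+\frac{16(1+7\lambda_w^2)^2E^2L^2\gamma^2}{(1-\lambda_w^2)^4}\Big(\frac{2577N\sigma^2}{|\mathcal I|}+\frac{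111\,\phi_v^0}{T}\Big).$$
   Context: Network: $N$ agents $[N]=\{1,\dots,N\}$ are the vertices of an undirected connected graph $\mathcal G=(\mathcal E,\mathcal V)$ with edge set $\mathcal E$. The mixing matrix $\mathbf W\in\mathbb R^{N\times N}$ satisfies $W_{n,m}>0$ for $(n,m)\in\mathcal E$ and $W_{n,m}=0$ otherwise, is doubly stochastic ($\mathbf W\mathbf 1=\mathbf 1$, $\mathbf 1^\top\mathbf W=\mathbf 1^\top$), and $\lambda_w:=\|\mathbf W-\frac1N\mathbf 1\mathbf 1^\top\|$ (largest singular value) satisfies $|\lambda_w|<1$. $\mathbf W$ need not be symmetric. Problem: $F(\mathbf y)=\frac1N\sum_{n=1}^N f_n(\mathbf y)$, $\mathbf y\in\mathbb R^p$, with $f_n:\mathbb R^p\to\mathbb R$ smooth and possibly nonconvex; $f_n(\mathbf y)=\mathbb E_{\xi\sim\mathcal D_n}[\ell_n(\mathbf y,\xi)]$ with local dataset $\mathcal D_n$ and loss $\ell_n$. Assumptions: $F(\mathbf y)\ge\underline F$ for all $\mathbf y$; $\|\nabla f_n(\mathbf y)-\nabla f_n(\mathbf y')\|\le L\|\mathbf y-\mathbf y'\|$ for all $\mathbf y,\mathbf y'$ and all $n$. Stochastic gradients: at a point $\mathbf y_n$, agent $n$ uses $\mathbf g_n=\frac1{|\mathcal I|}\sum_{\xi\in\mathcal I_n}\nabla\ell_n(\mathbf y_n;\xi)$, where $\mathcal I_n\subseteq\mathcal D_n$ is a randomly chosen mini-batch of size $|\mathcal I|$ (the same size for all agents). Assumption: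 $\mathbb E[\mathbf g_n]=\nabla f_n(\mathbf y_n)$ and $\mathbb E[\|\mathbf g_n-\nabla f_n(\mathbf y_n)\|^2]\le\sigma^2/|\mathcal I|$. LSGT algorithm (step size $\gamma>0$, integer $E\ge1$ local updates, rounds $r=0,1,\dots,T$): initialize $\mathbf y_1^0=\dots=\mathbf y_N^0$ and $\mathbf v_n^0=\mathbf g_n^0$, where $\mathbf g_n^0$ is a mini-batch gradient at $\mathbf y_n^0$. In round $r$ each agent $n$ sets $\mathbf y_n^{r,0}=\sum_m W_{n,m}\mathbf y_m^r$, $\mathbf v_n^{r,0}=\sum_m W_{n,m}\mathbf v_m^r$, $\mathbf g_n^{r,0}=\mathbf g_n^r$; then for $q=1,\dots,E$: $\mathbf y_n^{r,q}=\mathbf y_n^{r,q-1}-\gamma\mathbf v_n^{r,q-1}$, and $\mathbf v_n^{r,q}=\mathbf v_n^{r,q-1}+\mathbf g_n^{r,q}-\mathbf g_n^{r,q-1}$, where $\mathbf g_n^{r,q}$ is the mini-batch gradient at $\mathbf y_n^{r,q}$ with a randomly chosen mini-batch $\mathcal I_n^{r,q}\subseteq\mathcal D_n$; finally $\mathbf y_n^{r+1}=\mathbf y_n^{r,E}$, $\mathbf v_n^{r+1}=\mathbf v_n^{r,E}$, $\mathbf g_n^{r+1}=\mathbf g_n^{r,E}$. Notation: $\bar{\mathbf y}^r=\frac1N\sum_n\mathbf y_n^r$, $\bar{\mathbf v}^r=\frac1N\sum_n\mathbf v_n^r$, $\mathbf V^r=[\mathbf v_1^r,\dots,\mathbf v_N^r]^\top$,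 $\phi_v^r=\mathbb E[\|\mathbf V^r-\mathbf 1(\bar{\mathbf v}^r)^\top\|_F^2]$. *)

(* Defs.v *)
From HB Require Import structures.
From mathcomp Require Import all_boot all_order all_algebra.
From mathcomp Require Import all_classical all_reals all_analysis.

Set Implicit Arguments.
Unset Strict Implicit.
Unset Printing Implicit Defensive.

Import Order.TTheory GRing.Theory Num.Theory.
Import numFieldNormedType.Exports.

Local Open Scope classical_set_scope.
Local Open Scope ring_scope.

(** Vectors of R^p are rows; the N agents' vectors are stacked as the rows of a
    matrix in 'M_(N, p), so that sum_m W_(n,m) y_m is row n of W *m Y. *)

(* Frobenius norm, i.e. the Euclidean norm on rows (the library's norm on
   matrices is the sup norm). *)
Definition norm2 (R : realType) (m n : nat) (A : 'M[R]_(m, n)) : R :=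
  Num.sqrt (\sum_i \sum_j A i j ^+ 2).

Definition gradient (R : realType) (p : nat) (h : 'rV[R]_p -> R)
    (y : 'rV[R]_p) : 'rV[R]_p :=
  \row_(j < p) 'D_(delta_mx 0 j) h y.

Definition mean_row (R : realType) (N p : nat) (Y : 'M[R]_(N, p)) : 'rV[R]_p :=
  N%:R^-1 *: \sum_(n < N) row n Y.

Definition ones (R : realType) (N : nat) : 'cV[R]_N := const_mx 1.

Definition max_singular_value (R : realType) (N : nat) (A : 'M[R]_N) : R :=
  sup [set s | exists2 mu, eigenvalue (A^T *m A) mu & s = Num.sqrt mu].

Definition lambda_w (R : realType) (N : nat) (W : 'M[R]_N) : R :=
  max_singular_value (W - N%:R^-1 *: (ones R N *m (ones R N)^T)).

(* Self-loops are allowed in the graph e: the diagonal of W is governed by e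
   like every other entry. *)
Definition mixing_matrix (R : realType) (N : nat) (e : rel 'I_N)
    (W : 'M[R]_N) : Prop :=
  [/\ forall n m, e n m -> 0 < W n m,
      forall n m, ~~ e n m -> W n m = 0,
      W *m ones R N = ones R N &
      (ones R N)^T *m W = (ones R N)^T].

Definition undirected_connected (N : nat) (e : rel 'I_N) : Prop :=
  symmetric e /\ forall n m, connect e n m.

(* The expectation is E_(xi ~ D)[l(y, xi)]; [fine] is harmless where l y is
   integrable. *)
Definition local_objective (R : realType) (p : nat) (d : measure_display)
    (X : measurableType d) (D : probability X R) (l : 'rV[R]_p -> X -> R)
    (y : 'rV[R]_p) : R :=
  fine ('E_D[l y])%E.

Definition average_objective (R : realType) (N p : nat)
    (f : 'I_N -> 'rV[R]_p -> R) (y : 'rV[R]_p) : R :=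
  N%:R^-1 * \sum_(n < N) f n y.

(* A mini-batch of size b is a b-tuple of data points. *)
Definition minibatch_grad (R : realType) (p b : nat) (X : Type)
    (l : 'rV[R]_p -> X -> R) (y : 'rV[R]_p) (B : b.-tuple X) : 'rV[R]_p :=
  b%:R^-1 *: \sum_(i < b) gradient (fun y' => l y' (tnth B i)) y.

Definition stacked_grad (R : realType) (N p b : nat) (X : 'I_N -> Type)
    (l : forall n, 'rV[R]_p -> X n -> R) (B : forall n, b.-tuple (X n))
    (Y : 'M[R]_(N, p)) : 'M[R]_(N, p) :=
  \matrix_(n < N) minibatch_grad (l n) (row n Y) (B n).

Record lsgt_state (R : realType) (N p : nat) := LsgtState {
  st_y : 'M[R]_(N, p);
  st_v : 'M[R]_(N, p);
  st_g : 'M[R]_(N, p) }.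

Definition lsgt_mix (R : realType) (N p : nat) (W : 'M[R]_N)
    (s : lsgt_state R N p) : lsgt_state R N p :=
  LsgtState (W *m st_y s) (W *m st_v s) (st_g s).

Definition lsgt_local_step (R : realType) (N p : nat) (gamma : R)
    (G : 'M[R]_(N, p) -> 'M[R]_(N, p)) (s : lsgt_state R N p) :
    lsgt_state R N p :=
  let y := st_y s - gamma *: st_v s in
  let g := G y in
  LsgtState y (st_v s + g - st_g s) g.

Fixpoint lsgt_local (R : realType) (N p : nat) (gamma : R)
    (G : nat -> 'M[R]_(N, p) -> 'M[R]_(N, p)) (s : lsgt_state R N p)
    (q : nat) : lsgt_state R N p :=
  if q is q'.+1
  then lsgt_local_step gamma (G q) (lsgt_local gamma G s q')
  else s.

(* G r q is the stacked mini-batch gradient oracle of local update q of round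
   r; G 0 0 is the one used for the initialization. *)
Fixpoint lsgt (R : realType) (N p : nat) (W : 'M[R]_N) (gamma : R) (E : nat)
    (G : nat -> nat -> 'M[R]_(N, p) -> 'M[R]_(N, p)) (Y0 : 'M[R]_(N, p))
    (r : nat) : lsgt_state R N p :=
  if r is r'.+1
  then lsgt_local gamma (G r') (lsgt_mix W (lsgt W gamma E G Y0 r')) E
  else LsgtState Y0 (G 0%N 0%N Y0) (G 0%N 0%N Y0).

(* Indices (r, q) of the mini-batches drawn by each agent: (0, 0) for the
   initialization, and 1 <= q <= E in each of the rounds 0, ..., T. *)
Definition drawn (E T : nat) (rq : nat * nat) : bool :=
  (rq == (0, 0)%N) || ((rq.1 <= T)%N && (1 <= rq.2 <= E)%N).

Definition mutually_independent (R : realType) (d dZ : measure_display)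
    (Om : measurableType d) (P : probability Om R) (I : eqType)
    (S : I -> measurableType dZ) (Z : forall i, Om -> S i) (J : pred I) :
    Prop :=
  forall (s : seq I) (A : forall i, set (S i)),
    uniq s -> (forall i, i \in s -> J i) -> (forall i, measurable (A i)) ->
    P (\bigcap_(i in [set` s]) (Z i @^-1` A i)) =
    (\prod_(i <- s) P (Z i @^-1` A i))%E.

Definition independent_batches (R : realType) (d dX : measure_display)
    (Om : measurableType d) (P : probability Om R) (N b E T : nat)
    (X : 'I_N -> measurableType dX)
    (B : forall n, nat -> nat -> {RV P >-> b.-tuple (X n)}) : Prop :=
  mutually_independent P (I := ('I_N * (nat * nat))%type)
    (S := fun i => b.-tuple (X i.1)) (fun i => B i.1 i.2.1 i.2.2)
    (fun i => drawn E T i.2).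

Definition unbiased_bounded_variance (R : realType) (d dX : measure_display)
    (Om : measurableType d) (P : probability Om R) (p b : nat)
    (X : measurableType dX) (l : 'rV[R]_p -> X -> R) (f : 'rV[R]_p -> R)
    (sigma : R) (B : Om -> b.-tuple X) : Prop :=
  forall y : 'rV[R]_p,
    (forall j : 'I_p, ('E_P[fun w => (minibatch_grad l y (B w) 0 j)%R] =
                      (gradient f y 0 j)%R%:E)%E) /\
    ('E_P[fun w => (norm2 (minibatch_grad l y (B w) - gradient f y) ^+ 2)%R] <=
     (sigma ^+ 2 / b%:R)%R%:E)%E.

(* x / 0 = 0 in the library, hence the guard 1 < E on the second condition. *)
Definition small_step (R : realType) (N E : nat) (L lam gamma : R) : Prop :=
  let n : R := N%:R in
  let e : R := E%:R in
  (gamma <= lam ^+ 2 / (32 * e * n * L)) /\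
  ((1 < E)%N ->
     gamma <= (1 - lam ^+ 2) ^+ 2 /
       (32 * L ^+ 2 * (1 + 7 * lam ^+ 2) *
        (8 * (1 + 16 * lam ^+ 2) * (e - 1) ^+ 2))) /\
  (gamma <= (1 - lam ^+ 2) / (3600 * e * n * L)) /\
  (exists s1 s2 : R, [/\ 0 < s1, 0 < s2,
     s1 < (1 - lam ^+ 2) ^+ 2 /
          (40 * (1 + 7 * lam ^+ 2) * (1 + lam ^+ 2) * L ^+ 2) * s2 &
     gamma <= 3 * (1 - lam ^+ 2) * s1 /
       (16 * (1 + 7 * lam ^+ 2) * (1 + 8 * (e - 1) * lam) * s2)]) /\
  (gamma <= 3 * (1 - lam ^+ 2) ^+ 2 /
     (320 * (1 + 7 * lam ^+ 2) * (1 + lam ^+ 2) *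
      (1 + 8 * (e - 1) * lam) * n * L)) /\
  (gamma <= 1 / (62 * e * (1 + lam ^+ 2) * n * L)) /\
  (gamma <= (1 - lam ^+ 2) / (320 * e ^+ 2 * n * L)).

(* Main.v *)
(** Number the gradient evaluations of the run consecutively and write each
    stochastic gradient as the true gradient plus a noise.  For an arbitrary
    fixed realization of the noise, gradient tracking keeps the mean of the
    [v_n] equal to the mean of the [g_n], so the averaged iterate performs
    plain SGD steps and the descent lemma for [F] holds up to the consensus
    error.  As [W - J] with [J = (1/N) 1 1^T] contracts deviations from the mean
    by the factor [lambda], the consensus and tracking errors satisfy two linear
    recursions from round to round; their coupling is of order
    [(gamma L E)^2 / (1 - lambda^2)^4], which the step size condition makes at
    most [1/720^2], so the sums of both errors over the rounds are controlled by
    the noise, the initial tracking error and a small multiple of the gradient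
    norms.  Expectations enter only at the end: a batch is independent of the
    sigma-algebra generated by all the other batches, hence its noise has mean
    zero against every function of the past and of the other agents' noises. *)

Require Import Defs.
From HB Require Import structures.
From mathcomp Require Import all_boot all_order all_algebra.
From mathcomp Require Import all_classical all_reals all_analysis.
From mathcomp Require Import measurable_realfun ring lra.

Set Implicit Arguments.
Unset Strict Implicit.
Unset Printing Implicit Defensive.

Import Order.TTheory GRing.Theory Num.Theory.
Import numFieldNormedType.Exports.

Local Open Scope classical_set_scope.
Local Open Scope ring_scope.


(** * Independence and Fubini *)

(** Noise enters the pathwise inequalities in two ways. Linear noise terms occur only in the descent
    of the mean; their expectation vanishes, and orthogonality between agents reduces the remaining
    square to [sigma ^+ 2 / (N b)]. In the consensus and tracking errors the noise occurs squared,
    with a weight of order [gamma ^+ 2], and the plain variance bound suffices. The probabilistic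
    obstacle is that the oracle hypothesis speaks of deterministic points, whereas the run evaluates
    at random iterates; Fubini for independent variables freezes the iterate. On the deterministic
    side, descent happens at every local update, whereas the theorem counts gradients at round
    starts only, so the drift within a round has to be controlled too. The bound
    [gamma L E <= (1 - lambda^2)^2 / 720] combines step conditions (iii) and (v): the former is only
    linear in [1 - lambda^2], the latter loses its factor [E] as [lambda] tends to 0. Condition (i)
    forces [lambda > 0], needed because the Young parameter of the contraction has [lambda^2] in its
    denominator. *)

Definition indep_rv (R : realType) (d d1 d2 : measure_display)
    (Om : measurableType d) (P : probability Om R)
    (T1 : measurableType d1) (T2 : measurableType d2)
    (X : Om -> T1) (Y : Om -> T2) : Prop :=
  forall A B, measurable A -> measurable B ->
    P (X @^-1` A `&` Y @^-1` B) = (P (X @^-1` A) * P (Y @^-1` B))%E.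

Section independence.
Context (R : realType) (d d1 d2 : measure_display).
Context (Om : measurableType d) (P : probability Om R).
Context (T1 : measurableType d1) (T2 : measurableType d2).
Variables (X : {RV P >-> T1}) (Y : {RV P >-> T2}).
Hypothesis XY : indep_rv P X Y.

Let pairXY : Om -> T1 * T2 := fun w => (X w, Y w).

Let mpairXY : measurable_fun setT pairXY.
Proof. exact: measurable_fun_pair. Qed.

HB.instance Definition _ := isMeasurableFun.Build _ _ _ _ pairXY mpairXY.

Let pair_law (Z : set (T1 * T2)) : measurable Z ->
  (distribution P X \x distribution P Y)%E Z = distribution P pairXY Z.
Proof.
apply: product_measure_unique => A B mA mB.
by rewrite /distribution /pushforward /= -XY.
Qed.

(** Freezing: the joint law is the product law, so Tonelli applies. Both integrals are pulled back
    to [Om], so [X] can later be the identity onto a coarser sigma-algebra. *)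
Lemma indep_ge0_integral (f : T1 * T2 -> \bar R) :
  measurable_fun [set: T1 * T2] f -> (forall z, 0 <= f z)%E ->
  (\int[P]_w f (X w, Y w) = \int[P]_w \int[P]_w' f (X w, Y w'))%E.
Proof.
move=> mf f0.
rewrite -[LHS](ge0_integral_distribution (pairXY : {RV P >-> (T1 * T2)%type}) mf f0).
rewrite -(eq_measure_integral _ (fun Z mZ _ => pair_law mZ)).
rewrite fubini_tonelli1//.
rewrite /fubini_F ge0_integral_distribution; last 2 first.
- exact: measurable_fun_fubini_tonelli_F.
- by move=> x; apply: integral_ge0.
apply: eq_integral => w _ /=.
rewrite ge0_integral_distribution//.
by apply: measurableT_comp => //; exact: measurable_pair1.
Qed.

(** Signed version. Integrability is asked of every section, not of almost every one, so that the
    inner integral can be transported from the law of [Y] at each point. *)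
Lemma indep_integral (f : T1 * T2 -> R) :
  measurable_fun [set: T1 * T2] f ->
  P.-integrable setT (fun w => (f (X w, Y w))%:E) ->
  (forall x, P.-integrable setT (fun w => (f (x, Y w))%:E)) ->
  (\int[P]_w (f (X w, Y w))%:E = \int[P]_w \int[P]_w' (f (X w, Y w'))%:E)%E.
Proof.
move=> mf If If'.
have mf' : measurable_fun [set: T1 * T2] (EFin \o f) by exact/measurable_EFinP.
rewrite -[LHS](integral_distribution (X := (pairXY : {RV P >-> (T1 * T2)%type})) mf' If).
rewrite -(eq_measure_integral _ (fun Z mZ _ => pair_law mZ)).
have Ip : (distribution P X \x distribution P Y)%E.-integrable setT (EFin \o f).
  apply/integrableP; split=> //.
  rewrite (eq_measure_integral _ (fun Z mZ _ => pair_law mZ)).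
  rewrite (ge0_integral_distribution (pairXY : {RV P >-> (T1 * T2)%type})) //; last first.
    by apply: measurableT_comp.
  by have /integrableP[] := If.
rewrite -integral12_prod_meas1//.
have iF := integrable_fubini_F Ip.
rewrite integral_distribution; last 2 first.
- by case/integrableP: iF.
- rewrite -[_ \o _]/(_ \o _); apply/integrableP; split.
    by apply: measurableT_comp => //; case/integrableP: iF.
  case/integrableP: iF => mF.
  by rewrite ge0_integral_distribution //; apply: measurableT_comp.
apply: eq_integral => w _ /=.
rewrite /fubini_F integral_distribution; [by []| |exact: If'].
by apply: measurableT_comp => //; exact: measurable_pair1.
Qed.

End independence.

Section other_sigma.
Context (R : realType) (d dZ : measure_display).
Context (Om : measurableType d) (P : probability Om R) (I : eqType).
Context (S : I -> measurableType dZ) (Z : forall i, {RV P >-> S i}).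

(* For a fixed list [s] these sets form a pi-system, so that the independence of
   [Z i] from the family indexed by [s] extends to the generated sigma-algebra. *)
Definition cylinder (s : seq I) : set (set Om) :=
  [set \bigcap_(j in [set` s]) (Z j @^-1` A j) |
    A in [set A : forall j, set (S j) | forall j, measurable (A j)]].

Lemma cylinder_measurable s : cylinder s `<=` measurable.
Proof.
move=> _ [A mA <-]; apply: fin_bigcap_measurable; first exact: finite_seq.
by move=> j _; apply: measurable_funPTI; exact: mA.
Qed.

Lemma setI_closed_cylinder s : setI_closed (cylinder s).
Proof.
move=> _ _ [A mA <-] [A' mA' <-]; exists (fun j => A j `&` A' j).
  by move=> j; apply: measurableI.
by rewrite -bigcapI; apply: eq_bigcapr => j _; rewrite preimage_setI.
Qed.

Lemma cylinderT s : cylinder s setT.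
Proof.
exists (fun=> setT) => [j|]; first exact: measurableT.
by apply: bigcapT.
Qed.

Lemma measurable_cylinder s j : j \in s ->
  measurable_fun [set: g_sigma_algebraType (cylinder s)] (Z j : Om -> S j).
Proof.
move=> js _ B mB; rewrite setTI; apply: sub_sigma_algebra.
exists (@dfwith I (fun k => set (S k)) (fun k => setT) j B).
  by move=> k; case: (eqVneq j k) => [<-|jk]; rewrite ?dfwithin ?dfwithout//; exact: measurableT.
rewrite eqEsubset; split=> w.
  by move=> /(_ j js) /=; rewrite dfwithin.
by move=> Bw k _ /=; case: (eqVneq j k) => [<-|jk]; rewrite ?dfwithin ?dfwithout.
Qed.

Lemma sub_cylinder_measurable s : <<s cylinder s >> `<=` (measurable : set (set Om)).
Proof.
apply: smallest_sub; first exact: sigma_algebra_measurable.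
exact: cylinder_measurable.
Qed.

(** For fixed [C], the measures [A |-> P (A & Z i @^-1] C)[and]A |-> P (Z i @^-1[C) * P A] agree on
    the cylinders, hence on the sigma-algebra they generate. *)
Lemma indep_cylinder (J : pred I) s i :
  mutually_independent P Z J -> uniq (i :: s) -> {subset i :: s <= J} ->
  indep_rv P (id : Om -> g_sigma_algebraType (cylinder s)) (Z i).
Proof.
move=> indep us sJ A C mA mC; rewrite preimage_id.
have mZC : measurable (Z i @^-1` C) by exact: measurable_funPTI.
have PCfin : P (Z i @^-1` C) \is a fin_num by exact: fin_num_measure.
have r0 : 0 <= fine (P (Z i @^-1` C)) by rewrite fine_ge0.
rewrite muleC -(fineK PCfin).
apply: (g_sigma_algebra_measure_unique (cylinder s) _ (fun=> setT) _ _
  (mrestr P mZC) (mscale (NngNum r0) P)) => //.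
- exact: cylinder_measurable.
- by move=> _; exact: cylinderT.
- by rewrite bigcup_const.
- exact: setI_closed_cylinder.
- move=> _ [B mB <-].
  have /= us' : uniq s by case/andP: us.
  have iNs : i \notin s by case/andP: us.
  rewrite /mrestr /mscale /= fineK//.
  (* Placing [C] at the extra index [i] turns the intersection into one cylinder over [i :: s];
     mutual independence is then used for [i :: s] and for [s]. *)
  pose B' := @dfwith I (fun k => set (S k)) B i C.
  have B'E j : j \in s -> B' j = B j.
    by move=> js; rewrite /B' dfwithout//; apply: contraNneq iNs => ->.
  have mB' j : measurable (B' j).
    by rewrite /B'; case: (eqVneq i j) => [<-|ij]; rewrite ?dfwithin ?dfwithout.
  have iI (H : I -> set Om) :
      \bigcap_(j in [set` i :: s]) H j = H i `&` \bigcap_(j in [set` s]) H j.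
    rewrite -bigcap_setU1; congr (\bigcap_(j in _) H j).
    rewrite eqEsubset; split=> j /=; rewrite inE.
      by case/orP=> [/eqP|]; [left|right].
    by case=> [->|->]; rewrite ?eqxx ?orbT.
  have sE : \bigcap_(j in [set` s]) (Z j @^-1` B' j) = \bigcap_(j in [set` s]) (Z j @^-1` B j).
    by apply: eq_bigcapr => j /B'E ->.
  have Pi := indep (i :: s) B' us sJ mB'.
  have sJ' j : j \in s -> J j by move=> js; apply: sJ; rewrite inE js orbT.
  have Ps := indep s B' us' sJ' mB'.
  by rewrite iI big_cons -Ps sE /B' dfwithin in Pi; rewrite setIC Pi.
- by move=> k; rewrite /= ltey_eq fin_num_measure//; exact: measurableT.
Qed.

End other_sigma.

(** * Measurability of gradients *)

Lemma cvg_row (R : realType) (p : nat) (u : nat -> 'rV[R]_p) (y : 'rV[R]_p) :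
  (forall j, u k ord0 j @[k --> \oo] --> y ord0 j) -> u k @[k --> \oo] --> y.
Proof.
move=> uy; apply/cvgrPdist_le => e e0.
have : \forall k \near \oo, forall j : 'I_p, `|y ord0 j - u k ord0 j| <= e.
  by apply: filter_forall => j; have /cvgrPdist_le := uy j; apply.
apply: filterS => k yuk; rewrite /Num.norm /= mx_normrE.
by apply/bigmax_leP; split=> [|[i j] _ /=]; rewrite ?(ltW e0)// (ord1 i) !mxE.
Qed.

(** Iterate and batch vary together, while the losses are measurable only in the data point for each
    fixed [y]; continuity in [y] supplies the joint measurability. *)
Lemma measurable_carath (R : realType) (p : nat) (dT dX : measure_display)
    (T : measurableType dT) (X : measurableType dX)
    (l : 'rV[R]_p -> X -> R) (Y : T -> 'rV[R]_p) (xi : T -> X) :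
  (forall x, continuous (l ^~ x)) -> (forall y, measurable_fun setT (l y)) ->
  (forall j, measurable_fun setT (fun w => Y w ord0 j)) ->
  measurable_fun setT xi ->
  measurable_fun setT (fun w => l (Y w) (xi w)).
Proof.
move=> lc lm mY mxi.
(* Rounding [Y] to the grid of mesh [1 / (k + 1)] gives countably many values,
   on each of which [l y] is measurable; continuity passes to the limit. *)
pose z k w : 'rV[int]_p := \row_j Num.floor (Y w ord0 j * k.+1%:R).
pose q k (a : 'rV[int]_p) : 'rV[R]_p := \row_j ((a ord0 j)%:~R / k.+1%:R).
apply: (measurable_fun_cvg (h := fun k w => l (q k (z k w)) (xi w))); last first.
  move=> w _; have := @continuous_cvg _ _ _ _ _ (fun k => q k (z k w)) _ _ (lc (xi w) (Y w)).
  apply; apply: cvg_row => j; apply/cvgrPdist_le => e e0.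
  have := @cvg_harmonic R; move/cvgrPdist_le => /(_ _ e0).
  apply: filterS => k; rewrite sub0r normrN => ke; apply: le_trans ke.
  rewrite /harmonic /= [leRHS]ger0_norm ?invr_ge0// !mxE.
  set a := Y w ord0 j; have k0 : 0 < (k.+1%:R : R) by [].
  have /andP[lo hi] := floor_itv (a * k.+1%:R).
  have -> : a - (Num.floor (a * k.+1%:R))%:~R / k.+1%:R =
      (a * k.+1%:R - (Num.floor (a * k.+1%:R))%:~R) / k.+1%:R.
    by rewrite mulrBl mulfK// lt0r_neq0.
  rewrite normrM normfV (ger0_norm (ltW k0)) -[leRHS]mul1r ler_pM2r ?invr_gt0//.
  by move: hi; rewrite intrD => hi; rewrite ger0_norm; lra.
move=> k _ B mB; rewrite setTI.
have -> : (fun w => l (q k (z k w)) (xi w)) @^-1` B =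
    \bigcup_(a : 'rV[int]_p) ([set w | z k w = a] `&` (xi @^-1` (l (q k a) @^-1` B))).
  rewrite eqEsubset; split=> w /=; first by move=> Bw; exists (z k w).
  by case=> a _ [<-].
apply: countable_bigcupT_measurable => [|a]; first exact: countableP.
apply: measurableI; last first.
  by rewrite -[_ @^-1` _]setTI; apply: mxi => //; rewrite -[_ @^-1` _]setTI; apply: lm.
have -> : [set w | z k w = a] = \bigcap_(j in [set: 'I_p])
    ((fun w => Y w ord0 j * k.+1%:R) @^-1` `[(a ord0 j)%:~R, (a ord0 j + 1)%:~R[).
  rewrite eqEsubset; split=> w /=.
    by move=> <- j _ /=; rewrite in_itv /= !mxE floor_itv.
  move=> H; apply/rowP => j; rewrite mxE; apply/eqP; rewrite floor_eq.
  by have := H j I; rewrite /= in_itv.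
apply: fin_bigcap_measurable; first exact: finite_finset.
move=> j _; rewrite -[_ @^-1` _]setTI.
by apply: measurable_funM => //; exact: measurable_itv.
Qed.

(** A countable sequence of difference quotients suffices, which makes a partial derivative a
    pointwise limit of measurable functions. *)
Lemma derive_seq_cvg (R : realType) (p : nat) (h : 'rV[R]_p -> R) (y v : 'rV[R]_p) :
  differentiable h y ->
  k.+1%:R * (h (y + k.+1%:R^-1 *: v) - h y) @[k --> \oo] --> 'D_v h y.
Proof.
move=> /(diff_derivable (v := v)) dh.
have /cvgr_dnbhsP H := dh.
have /H : (forall k, (k.+1%:R^-1 : R) != 0) /\ (k.+1%:R^-1 @[k --> \oo] --> (0 : R)).
  by split=> [k|]; [rewrite invr_eq0 pnatr_eq0|exact: cvg_harmonic].
apply: cvg_trans; apply: near_eq_cvg; near=> k.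
by rewrite /= invrK [y + _]addrC.
Unshelve. all: by end_near. Qed.

Section measurable_gradients.
Context (R : realType) (p : nat) (dT dX : measure_display).
Context (T : measurableType dT) (X : measurableType dX).
Variables (l : 'rV[R]_p -> X -> R).
Hypothesis ldiff : forall x y, differentiable (l ^~ x) y.
Hypothesis lmeas : forall y, measurable_fun setT (l y).
Variable (Y : T -> 'rV[R]_p).
Hypothesis mY : forall j, measurable_fun setT (fun w => Y w ord0 j).

Lemma measurable_gradient (xi : T -> X) j : measurable_fun setT xi ->
  measurable_fun setT (fun w => gradient (l ^~ (xi w)) (Y w) ord0 j).
Proof.
move=> mxi.
have lc x : continuous (l^~ x) by move=> y; exact: differentiable_continuous.
pose e : 'rV[R]_p := delta_mx 0 j.
apply: (measurable_fun_cvg (h := fun k w => k.+1%:R *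
    (l (Y w + k.+1%:R^-1 *: e) (xi w) - l (Y w) (xi w)))); last first.
  by move=> w _; rewrite mxE; exact: derive_seq_cvg.
move=> k; apply: measurable_funM => //; apply: measurable_funB; last first.
  exact: measurable_carath.
apply: (@measurable_carath _ _ _ _ _ _ l (fun w => Y w + k.+1%:R^-1 *: e)) => // i.
rewrite [X in measurable_fun _ X](_ : _ = (fun w => Y w ord0 i + (k.+1%:R^-1 *: e) ord0 i)).
  exact: measurable_funD.
by apply/funext => w; rewrite mxE.
Qed.

Lemma measurable_minibatch_grad b (B : T -> b.-tuple X) j : measurable_fun setT B ->
  measurable_fun setT (fun w => minibatch_grad l (Y w) (B w) ord0 j).
Proof.
move=> mB; rewrite [X in measurable_fun _ X](_ : _ = (fun w => b%:R^-1 *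
    \sum_(i < b) gradient (l ^~ (tnth (B w) i)) (Y w) ord0 j)).
  apply: measurable_funM => //; apply: measurable_sum => i.
  apply: (@measurable_gradient (fun w => tnth (B w) i)).
  exact: (measurableT_comp (measurable_tnth i) mB).
by apply/funext => w; rewrite !mxE summxE.
Qed.

End measurable_gradients.

(** * Integrability and one-sided bounds on means *)

Section square_integrable.
Context (R : realType) (d : measure_display) (Om : measurableType d).
Variable P : probability Om R.
Implicit Types f g : Om -> R.

Definition L1 f := P.-integrable setT (EFin \o f).

Definition L2 f := measurable_fun setT f /\ L1 (fun w => f w ^+ 2).

Lemma L1_cst c : L1 (fun=> c).
Proof. exact: finite_measure_integrable_cst. Qed.

Lemma L1_add f g : L1 f -> L1 g -> L1 (fun w => f w + g w).
Proof. by move=> If Ig; have := integrableD measurableT If Ig. Qed.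

Lemma L1_scale a f : L1 f -> L1 (fun w => a * f w).
Proof.
move=> If; have := integrableZl measurableT a If.
by apply: eq_integrable.
Qed.

Lemma L1_sum (I : Type) (s : seq I) (F : I -> Om -> R) :
  (forall i, L1 (F i)) -> L1 (fun w => \sum_(i <- s) F i w).
Proof.
move=> IF; elim: s => [|i s IH].
  by under [X in L1 X]eq_fun do rewrite big_nil; exact: L1_cst.
by under [X in L1 X]eq_fun do rewrite big_cons; exact: L1_add.
Qed.

Lemma L1_dom f g : measurable_fun setT f -> (forall w, `|f w| <= g w) -> L1 g -> L1 f.
Proof.
move=> mf fg; apply: le_integrable => //; first exact/measurable_EFinP.
by move=> w _ /=; rewrite lee_fin (le_trans (fg w)) ?ler_norm.
Qed.

Lemma L2_L1_mul f g : L2 f -> L2 g -> L1 (fun w => f w * g w).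
Proof.
move=> [mf If] [mg Ig]; apply: L1_dom (L1_add If Ig); first exact: measurable_funM.
move=> w; rewrite ler_norml; apply/andP; split.
  by have := sqr_ge0 (f w + g w); nra.
by have := sqr_ge0 (f w - g w); nra.
Qed.

Lemma L2_cst c : L2 (fun=> c).
Proof. by split=> //; exact: L1_cst. Qed.

Lemma L2_L1 f : L2 f -> L1 f.
Proof.
move=> /L2_L1_mul /(_ (L2_cst 1)); rewrite /L1.
by under [X in P.-integrable _ (_ \o X)]eq_fun do rewrite mulr1.
Qed.

Lemma L2_dom f g : measurable_fun setT f -> (forall w, f w ^+ 2 <= g w) -> L1 g -> L2 f.
Proof.
move=> mf fg Ig; split=> //; apply: L1_dom Ig; first exact: measurable_funX.
by move=> w; rewrite ger0_norm ?sqr_ge0.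
Qed.

Lemma L2_add f g : L2 f -> L2 g -> L2 (fun w => f w + g w).
Proof.
move=> [mf If] [mg Ig].
apply: (L2_dom (g := fun w => 2 * (f w ^+ 2 + g w ^+ 2))).
- exact: measurable_funD.
- by move=> w; have := sqr_ge0 (f w - g w); nra.
- by apply: L1_scale; exact: L1_add.
Qed.

Lemma L2_scale a f : L2 f -> L2 (fun w => a * f w).
Proof.
move=> [mf If]; apply: (L2_dom (g := fun w => a ^+ 2 * f w ^+ 2)).
- exact: measurable_funM.
- by move=> w; rewrite exprMn.
- exact: L1_scale.
Qed.

(** Carrying integrability along with the bound lets a pathwise inequality be averaged term by term
    without separate finiteness conditions. *)
Definition mean_le f c := L1 f /\ (\int[P]_w (f w)%:E <= c%:E)%E.

Lemma mean_le_cst c : mean_le (fun=> c) c.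
Proof.
split; first exact: L1_cst.
by rewrite integral_cst//= probability_setT mule1.
Qed.

Lemma mean_le_add f g a b : mean_le f a -> mean_le g b ->
  mean_le (fun w => f w + g w) (a + b).
Proof.
move=> [If fa] [Ig gb]; split; first exact: L1_add.
by have := integralD_EFin measurableT If Ig => /= ->; rewrite EFinD leeD.
Qed.

Lemma mean_le_scale k f a : 0 <= k -> mean_le f a -> mean_le (fun w => k * f w) (k * a).
Proof.
move=> k0 [If fa]; split; first exact: L1_scale.
under eq_integral do rewrite EFinM.
by rewrite integralZl// EFinM lee_wpmul2l.
Qed.

Lemma mean_le_sum (I : Type) (s : seq I) (F : I -> Om -> R) (c : I -> R) :
  (forall i, mean_le (F i) (c i)) ->
  mean_le (fun w => \sum_(i <- s) F i w) (\sum_(i <- s) c i).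
Proof.
move=> IF; elim: s => [|i s IH].
  rewrite big_nil; under [X in mean_le X _]eq_fun do rewrite big_nil.
  exact: mean_le_cst.
rewrite big_cons; under [X in mean_le X _]eq_fun do rewrite big_cons.
exact: mean_le_add.
Qed.

Lemma mean_le_dom f g c : L1 f -> (forall w, f w <= g w) -> mean_le g c -> mean_le f c.
Proof.
move=> If fg [Ig gc]; split=> //; apply: le_trans gc.
by apply: le_integral => // w _; rewrite lee_fin.
Qed.

Lemma mean_le0 k f : L1 f -> (\int[P]_w (f w)%:E = 0)%E -> mean_le (fun w => k * f w) 0.
Proof.
move=> If f0; split; first exact: L1_scale.
by under eq_integral do rewrite EFinM; rewrite integralZl// f0 mule0.
Qed.

Lemma ge0_mean_le f c : measurable_fun setT f -> (forall w, 0 <= f w) ->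
  (\int[P]_w (f w)%:E <= c%:E)%E -> mean_le f c.
Proof.
move=> mf f0 fc; split=> //; apply/integrableP; split; first exact/measurable_EFinP.
apply: le_lt_trans (ltry c); apply: le_trans fc.
by under eq_integral => w _ do rewrite /= ger0_norm//.
Qed.

End square_integrable.

Lemma norm2_sqr (R : realType) m n (A : 'M[R]_(m, n)) :
  norm2 A ^+ 2 = \sum_i \sum_j A i j ^+ 2.
Proof.
by rewrite sqr_sqrtr//; apply: sumr_ge0 => i _; apply: sumr_ge0 => j _; exact: sqr_ge0.
Qed.

Lemma measurable_norm2_sqr (R : realType) (d : measure_display) (T : measurableType d)
    m n (A : T -> 'M[R]_(m, n)) :
  (forall i j, measurable_fun setT (fun w => A w i j)) ->
  measurable_fun setT (fun w => norm2 (A w) ^+ 2).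
Proof.
move=> mA; under eq_fun do rewrite norm2_sqr.
by apply: measurable_sum => i; apply: measurable_sum => j; exact: measurable_funX.
Qed.

Lemma ler_norm2_sqr (R : realType) m n (A : 'M[R]_(m, n)) i j :
  A i j ^+ 2 <= norm2 A ^+ 2.
Proof.
rewrite norm2_sqr (bigD1 i)//= (bigD1 j)//= -addrA lerDl addr_ge0//.
  by apply: sumr_ge0 => k _; exact: sqr_ge0.
by apply: sumr_ge0 => k _; apply: sumr_ge0 => k' _; exact: sqr_ge0.
Qed.

(** * Noise of a mini-batch gradient at a random point independent of the batch *)

Section oracle_noise.
Context (R : realType) (p b : nat) (d d1 dX : measure_display).
Context (Om : measurableType d) (P : probability Om R).
Context (T1 : measurableType d1) (X : measurableType dX).
Variables (l : 'rV[R]_p -> X -> R) (f : 'rV[R]_p -> R) (sigma : R).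
Hypothesis ldiff : forall x y, differentiable (l ^~ x) y.
Hypothesis lmeas : forall y, measurable_fun setT (l y).
Hypothesis fdiff : forall y, differentiable f y.
Variables (V : {RV P >-> T1}) (B : {RV P >-> b.-tuple X}).
Hypothesis VB : indep_rv P V B.
Hypothesis hB : unbiased_bounded_variance P l f sigma B.
Variable Y : T1 -> 'rV[R]_p.
Hypothesis mY : forall j, measurable_fun setT (fun w => Y w ord0 j).

Let err (z : T1 * b.-tuple X) : 'rV[R]_p :=
  minibatch_grad l (Y z.1) z.2 - gradient f (Y z.1).

Let noise w := err (V w, B w).

Let merr j : measurable_fun [set: T1 * b.-tuple X] (fun z => err z ord0 j).
Proof.
have mY1 i : measurable_fun [set: T1 * b.-tuple X] (fun z => Y z.1 ord0 i).
  exact: (measurableT_comp (mY i) measurable_fst).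
rewrite [X in measurable_fun _ X](_ : _ = (fun z => minibatch_grad l (Y z.1) z.2 ord0 j -
    gradient f (Y z.1) ord0 j)); last by apply/funext => z; rewrite !mxE.
apply: measurable_funB.
  exact: (@measurable_minibatch_grad _ _ _ _ _ _ _ ldiff lmeas (fun z => Y z.1)).
(* [f] is treated as a loss that ignores its data, evaluated at the dummy data [point]. *)
apply: (@measurable_gradient _ _ _ _ _ X (fun y _ => f y) _ _ (fun z => Y z.1) mY1
  (fun z => point)) => //.
Qed.

Let mVB : measurable_fun setT (fun w => (V w, B w)).
Proof. exact: measurable_fun_pair. Qed.

Lemma measurable_noise j : measurable_fun setT (fun w => noise w ord0 j).
Proof. exact: (measurableT_comp (merr j) mVB). Qed.

(** The variance bound is known at each fixed point; freezing [V] applies it at [Y (V w)], and the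
    bound does not depend on [w]. *)
Lemma noise_variance :
  mean_le P (fun w => norm2 (noise w) ^+ 2) (sigma ^+ 2 / b%:R).
Proof.
apply: ge0_mean_le; first 2 last.
- pose F z := (norm2 (err z) ^+ 2)%:E.
  have mF : measurable_fun setT F.
    by apply/measurable_EFinP; apply: measurable_norm2_sqr => i j; rewrite (ord1 i).
  have F0 z : (0 <= F z)%E by rewrite lee_fin sqr_ge0.
  rewrite -[leLHS]/(\int[P]_w F (V w, B w))%E indep_ge0_integral//.
  rewrite -[leRHS]mul1e -(@probability_setT _ _ _ P) muleC -integral_cst//.
  apply: ge0_le_integral => //.
  + by move=> w _; apply: integral_ge0 => w' _; rewrite lee_fin sqr_ge0.
  + rewrite [X in measurable_fun _ X](_ : _ = fubini_F (distribution P B) F \o V).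
      by apply: measurableT_comp => //; exact: measurable_fun_fubini_tonelli_F.
    apply/funext => w; rewrite [RHS](_ : _ = \int[distribution P B]_y F (V w, y))%E//.
    have mFw : measurable_fun setT (fun y => F (V w, y)).
      by apply: (measurableT_comp mF); exact: measurable_pair1.
    by rewrite (ge0_integral_distribution B mFw (fun y => F0 (V w, y))).
  + by move=> w _; have [_] := hB (Y (V w)); rewrite unlock.
- by apply: measurable_norm2_sqr => i j; rewrite (ord1 i); exact: measurable_noise.
- by move=> w; exact: sqr_ge0.
Qed.

Lemma noise_L2 j : L2 P (fun w => noise w ord0 j).
Proof.
apply: L2_dom (measurable_noise j) _ noise_variance.1 => w.
exact: ler_norm2_sqr.
Qed.

(** Replaces a conditional expectation: with [V] frozen, [U (V w)] is a constant that leaves the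
    inner integral, and what remains has mean zero by unbiasedness. *)
Lemma noise_orthogonal (U : T1 -> R) j : measurable_fun setT U ->
  L2 P (fun w => U (V w)) ->
  (\int[P]_w (U (V w) * noise w ord0 j)%:E = 0)%E.
Proof.
move=> mU LU.
have Ierr y : L2 P (fun w => (minibatch_grad l y (B w) - gradient f y) ord0 j).
  have [_] := hB y; rewrite unlock => vB.
  have mn : forall i k, measurable_fun setT
      (fun w => (minibatch_grad l y (B w) - gradient f y) i k).
    move=> i k; rewrite (ord1 i).
    rewrite [X in measurable_fun _ X](_ : _ = (fun w => minibatch_grad l y (B w) ord0 k -
      gradient f y ord0 k)); last by apply/funext => w; rewrite !mxE.
    apply: measurable_funB => //.
    exact: (@measurable_minibatch_grad _ _ _ _ _ _ _ ldiff lmeas (fun z => y)).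
  have [I2 _] := ge0_mean_le (measurable_norm2_sqr mn) (fun w => sqr_ge0 _) vB.
  by apply: L2_dom (mn ord0 j) _ I2 => w; exact: ler_norm2_sqr.
pose F (z : T1 * b.-tuple X) := U z.1 * err z ord0 j.
rewrite -[LHS]/(\int[P]_w (F (V w, B w))%:E)%E.
rewrite indep_integral//; last 3 first.
- by apply: measurable_funM => //; exact: (measurableT_comp mU measurable_fst).
- exact: (L2_L1_mul LU (noise_L2 j)).
- by move=> x; exact: (L1_scale (U x) (L2_L1 (Ierr (Y x)))).
apply: integral0_eq => w _.
pose e w' := err (V w, B w') ord0 j.
transitivity (\int[P]_w' ((U (V w))%:E * (e w')%:E))%E.
  by apply: eq_integral => w' _; rewrite -EFinM.
have Ie : P.-integrable setT (EFin \o e) by exact: (L2_L1 (Ierr (Y (V w)))).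
rewrite (integralZl measurableT Ie (U (V w))) /e {e Ie}.
have -> : (\int[P]_w' (err (V w, B w') ord0 j)%:E = 0)%E; last by rewrite mule0.
have [/(_ j) mB _] := hB (Y (V w)).
move: mB; rewrite unlock => mB.
rewrite /err.
have Imb : L1 P (fun w' => minibatch_grad l (Y (V w)) (B w') ord0 j).
  have := L1_add (L2_L1 (Ierr (Y (V w)))) (L1_cst P (gradient f (Y (V w)) ord0 j)).
  by apply: eq_integrable => // w' _ /=; rewrite !mxE subrK.
have ID := integralD_EFin measurableT Imb (L1_cst P (- gradient f (Y (V w)) ord0 j)).
transitivity (\int[P]_w' ((minibatch_grad l (Y (V w)) (B w') ord0 j)%:E +
    (- gradient f (Y (V w)) ord0 j)%:E))%E.
  by apply: eq_integral => w' _; rewrite -EFinD !mxE.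
rewrite [LHS]ID.
by rewrite [X in (X + _)%E]mB integral_cst//= probability_setT mule1 -EFinD subrr.
Qed.

End oracle_noise.

(** * Frobenius norm and the largest singular value *)

Section frobenius.
Context (R : realType) (m n : nat).
Implicit Types A B C : 'M[R]_(m, n).

Definition dot A B : R := \sum_i \sum_j A i j * B i j.

Definition sq A : R := norm2 A ^+ 2.

Lemma sqE A : sq A = dot A A.
Proof. exact: norm2_sqr. Qed.

Lemma sq_ge0 A : 0 <= sq A. Proof. exact: sqr_ge0. Qed.

Lemma dotC A B : dot A B = dot B A.
Proof. by apply: eq_bigr => i _; apply: eq_bigr => j _; rewrite mulrC. Qed.

Lemma dotDl A B C : dot (A + B) C = dot A C + dot B C.
Proof.
rewrite -big_split; apply: eq_bigr => i _; rewrite -big_split; apply: eq_bigr => j _.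
by rewrite mxE mulrDl.
Qed.

Lemma dotZl a A B : dot (a *: A) B = a * dot A B.
Proof.
rewrite mulr_sumr; apply: eq_bigr => i _; rewrite mulr_sumr; apply: eq_bigr => j _.
by rewrite mxE mulrA.
Qed.

Lemma dotNl A B : dot (- A) B = - dot A B.
Proof. by rewrite -scaleN1r dotZl mulN1r. Qed.

Lemma dotDr A B C : dot A (B + C) = dot A B + dot A C.
Proof. by rewrite dotC dotDl dotC [dot C A]dotC. Qed.

Lemma dotZr a A B : dot A (a *: B) = a * dot A B.
Proof. by rewrite dotC dotZl dotC. Qed.

Lemma dotNr A B : dot A (- B) = - dot A B.
Proof. by rewrite dotC dotNl dotC. Qed.

Lemma sq0 : sq 0 = 0.
Proof. by rewrite sqE -(scale0r 0) dotZl mul0r. Qed.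

Lemma sqZ a A : sq (a *: A) = a ^+ 2 * sq A.
Proof. by rewrite !sqE dotZl dotZr mulrA expr2. Qed.

Lemma sqN A : sq (- A) = sq A.
Proof. by rewrite !sqE dotNl dotNr opprK. Qed.

Lemma sqD A B : sq (A + B) = sq A + 2 * dot A B + sq B.
Proof. by rewrite !sqE dotDl !dotDr (dotC B A); ring. Qed.

Lemma sqB A B : sq (A - B) = sq A - 2 * dot A B + sq B.
Proof. by rewrite sqD sqN dotNr; ring. Qed.

Lemma sq_eq0 A : sq A = 0 -> A = 0.
Proof.
rewrite /sq norm2_sqr => /eqP; rewrite psumr_eq0 => [/allP A0|i _]; last first.
  by apply: sumr_ge0 => j _; exact: sqr_ge0.
apply/matrixP => i j; rewrite mxE; have := A0 i (mem_index_enum _).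
rewrite /= psumr_eq0 => [/allP /(_ j (mem_index_enum _))|k _]; last exact: sqr_ge0.
by rewrite /= sqrf_eq0 => /eqP.
Qed.

Lemma sqD_young t A B : 0 < t -> sq (A + B) <= (1 + t) * sq A + (1 + t^-1) * sq B.
Proof.
move=> t0; rewrite sqD.
have := sq_ge0 (t *: A - B); rewrite sqB sqZ dotZl => H.
rewrite -subr_ge0 -(pmulr_rge0 _ t0).
have -> : t * ((1 + t) * sq A + (1 + t^-1) * sq B - (sq A + 2 * dot A B + sq B)) =
  t ^+ 2 * sq A - 2 * (t * dot A B) + sq B by field; exact: lt0r_neq0.
exact: H.
Qed.

Lemma sqD_le2 A B : sq (A + B) <= 2 * (sq A + sq B).
Proof. by have := sqD_young A B (ltr01 : 0 < (1 : R)); rewrite invr1; lra. Qed.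

Lemma sq_sum (A : nat -> 'M[R]_(m, n)) k :
  sq (\sum_(0 <= i < k) A i) <= k%:R * \sum_(0 <= i < k) sq (A i).
Proof.
elim: k => [|[|k] IH]; first by rewrite !big_geq// sq0 mul0r.
  by rewrite !big_nat1 mul1r.
rewrite big_nat_recr//= [X in _ * X]big_nat_recr//=.
set S := \sum_(0 <= i < k.+1) A i in IH *; set s := \sum_(0 <= i < k.+1) sq (A i) in IH *.
have k0 : 0 < (k.+1%:R : R) by [].
have s0 : 0 <= s by apply: sumr_ge0 => i _; exact: sq_ge0.
(* With [t = 1 / (k + 1)] both [(1 + t) (k + 1)] and [1 + 1 / t] equal [k + 2], so the induction
   closes with the sharp factor. *)
apply: le_trans (sqD_young S (A k.+1) (_ : 0 < k.+1%:R^-1)) _; first by rewrite invr_gt0.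
rewrite invrK mulrDr; apply: lerD; last by rewrite -[k.+2]addn1 natrD addrC.
apply: le_trans (ler_wpM2l _ IH) _; first by rewrite addr_ge0// invr_ge0.
rewrite mulrA ler_wpM2r// mulrDl mul1r mulVf ?lt0r_neq0//.
by rewrite -[k.+2]addn1 natrD.
Qed.

End frobenius.

Section more_frobenius.
Context (R : realType).

Lemma sq_rows m n (A : 'M[R]_(m, n)) : sq A = \sum_i sq (row i A).
Proof.
rewrite /sq norm2_sqr; apply: eq_bigr => i _; rewrite norm2_sqr big_ord1.
by apply: eq_bigr => j _; rewrite mxE.
Qed.

Lemma sq_tr m n (A : 'M[R]_(m, n)) : sq A^T = sq A.
Proof.
rewrite /sq !norm2_sqr exchange_big; apply: eq_bigr => i _; apply: eq_bigr => j _.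
by rewrite mxE.
Qed.

Lemma sq_cols m n (A : 'M[R]_(m, n)) : sq A = \sum_j sq (col j A).
Proof. by rewrite -sq_tr sq_rows; apply: eq_bigr => j _; rewrite -tr_col sq_tr. Qed.

Lemma dot_rowE n (u v : 'rV[R]_n) : dot u v = (u *m v^T) 0 0.
Proof. by rewrite /dot big_ord1 mxE; apply: eq_bigr => j _; rewrite mxE. Qed.

Lemma sq_mulmx_tr m n (A : 'M[R]_(m, n)) (u : 'rV[R]_n) :
  sq (A *m u^T) = dot (u *m (A^T *m A)) u.
Proof.
by rewrite -sq_tr trmx_mul trmxK sqE !dot_rowE trmx_mul trmxK !mulmxA.
Qed.

Lemma continuous_sumr (T : topologicalType) (I : Type) (s : seq I) (F : I -> T -> R) :
  (forall i, continuous (F i)) -> continuous (fun x => \sum_(i <- s) F i x).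
Proof.
move=> cF; elim: s => [|i s IH].
  by under eq_fun do rewrite big_nil; exact: cst_continuous.
by under eq_fun do rewrite big_cons; move=> x; apply: continuousD; [exact: cF|exact: IH].
Qed.

Lemma continuous_quadratic n (G : 'M[R]_n) :
  continuous (fun u : 'rV[R]_n => dot (u *m G) u).
Proof.
have E (u : 'rV[R]_n) : dot (u *m G) u = \sum_j (\sum_k u 0 k * G k j) * u 0 j.
  by rewrite /dot big_ord1; apply: eq_bigr => j _; rewrite mxE.
under eq_fun do rewrite E.
have cc j : continuous (fun u : 'rV[R]_n => u 0 j : R) by exact: coord_continuous.
apply: continuous_sumr => j u; apply: continuousM; last exact: cc.
apply: continuous_sumr => k {}u; apply: continuousM; first exact: cc.
exact: cst_continuous.
Qed.

(** A variational proof: the quadratic form attains its maximum on the compact unit sphere, and a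
    maximizer is an eigenvector. *)
Lemma rayleigh_max n (G : 'M[R]_n) : (0 < n)%N -> G^T = G ->
  exists2 mu, eigenvalue G mu & forall u : 'rV[R]_n, dot (u *m G) u <= mu * sq u.
Proof.
case: n G => // n G _ Gs.
pose S := [set u : 'rV[R]_n.+1 | sq u = 1].
have csq : continuous (fun u : 'rV[R]_n.+1 => sq u).
  have := @continuous_quadratic _ (1%:M : 'M[R]_n.+1).
  by under eq_fun do rewrite mulmx1 -sqE.
have S0 : S !=set0.
  exists (delta_mx 0 0); rewrite /S /= sqE /dot big_ord1 (bigD1 ord0)//= big1 => [|j jn0].
    by rewrite !mxE eqxx mulr1 addr0.
  by rewrite !mxE (negbTE jn0) mulr0.
have Sc : compact S.
  apply: bounded_closed_compact.
    exists 1; split=> // M M1 u /= Su; apply: le_trans (ltW M1).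
    rewrite /Num.norm /= mx_normrE; apply/bigmax_leP; split=> [|[i j] _ /=]; first exact: ler01.
    rewrite -(@expr_le1 _ 2)// real_normK ?num_real// -Su (ord1 i).
    exact: ler_norm2_sqr.
  rewrite (_ : S = (fun u => sq u) @^-1` [set 1])//.
  by apply: closed_comp => [u _|]; [exact: csq|exact: closed_eq].
have [u0 u0S maxu0] := EVT_max_rV S0 Sc (continuous_subspaceT (@continuous_quadratic _ G)).
have {}u0S : sq u0 = 1 by move: u0S; rewrite inE.
pose mu := dot (u0 *m G) u0.
have mumax (u : 'rV[R]_n.+1) : dot (u *m G) u <= mu * sq u.
  have [->|u_neq0] := eqVneq u 0; first by rewrite mul0mx -sqE sq0 mulr0.
  have squ : 0 < sq u.
    by rewrite lt_neqAle sq_ge0 andbT eq_sym; apply: contra_neq u_neq0; exact: sq_eq0.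
  pose c : R := (Num.sqrt (sq u))^-1.
  have c2 : c ^+ 2 * sq u = 1 by rewrite exprVn sqr_sqrtr ?ltW// mulVf// lt0r_neq0.
  have := maxu0 (c *: u); rewrite inE /S /= sqZ c2 => /(_ erefl).
  rewrite -scalemxAl dotZl dotZr mulrA -expr2 -/mu => H.
  rewrite -[leLHS]mul1r -c2 mulrAC; exact: (ler_wpM2r (ltW squ) H).
exists mu; last exact: mumax.
apply/eigenvalueP; exists u0; last first.
  by apply: contra_eq_neq u0S => ->; rewrite sq0 eq_sym oner_neq0.
(* Perturbing the maximizer [u0] in the direction of the residual [r] would
   increase the Rayleigh quotient if [r] were nonzero. *)
pose r := u0 *m G - mu *: u0.
have [r0|rn0] := eqVneq (sq r) 0.
  by apply/eqP; rewrite -subr_eq0; apply/eqP/sq_eq0.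
have sr : 0 < sq r by rewrite lt_neqAle eq_sym rn0 sq_ge0.
have Esr : sq r = dot (u0 *m G) r - mu * dot u0 r.
  by rewrite {1}sqE {1}/r dotDl dotNl dotZl.
clearbody r.
pose c := mu * sq r - dot (r *m G) r.
have c0 : 0 <= c by rewrite subr_ge0.
(* Maximality at [u0 + t *: r]: the first-order gain [2 t |r|^2] can be offset only by the
   second-order term. *)
have key t : 2 * t * sq r <= t ^+ 2 * c.
  have := mumax (u0 + t *: r).
  rewrite sqD sqZ dotZr u0S mulmxDl -scalemxAl dotDl !dotDr !dotZl !dotZr -/mu.
  have -> : dot (r *m G) u0 = dot (u0 *m G) r.
    by rewrite !dot_rowE -[u0 *m G *m r^T]trmxK [in RHS]mxE !trmx_mul trmxK Gs mulmxA.
  rewrite [X in 2 * t * X]Esr /c.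
  set a := dot (u0 *m G) r; set b := dot (r *m G) r; set e := dot u0 r.
  lra.
have c1 : 0 < c + 1 by rewrite ltr_wpDl.
(* For this [t] the inequality reduces to [2 (c + 1) <= c], impossible for [c >= 0]. *)
have := key (sq r / (c + 1)).
have -> : 2 * (sq r / (c + 1)) * sq r = (sq r / (c + 1)) ^+ 2 * (2 * (c + 1)).
  by field; exact: lt0r_neq0.
rewrite ler_pM2l; last by rewrite exprn_gt0// divr_gt0.
move=> H; have : c < c by lra.
by rewrite ltxx.
Qed.

(** The [sup] dominates [Num.sqrt mu] only if its set is bounded above; it is, since every
    eigenvalue of [A^T *m A] is a Rayleigh quotient and so at most [mu]. *)
Lemma max_singular_value_rayleigh N (A : 'M[R]_N) : (0 < N)%N ->
  exists2 mu, Num.sqrt mu <= max_singular_value A &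
    forall u : 'rV[R]_N, dot (u *m (A^T *m A)) u <= mu * sq u.
Proof.
move=> N0; have Gs : (A^T *m A)^T = A^T *m A by rewrite trmx_mul trmxK.
have [mu mueig mumax] := rayleigh_max N0 Gs.
exists mu => //; apply: ub_le_sup; last by exists mu.
exists (Num.sqrt mu) => _ [mu' /eigenvalueP[v vG v0] ->].
rewrite ler_wsqrtr//.
have sv : 0 < sq v.
  by rewrite lt_neqAle sq_ge0 andbT eq_sym; apply: contra_neq v0; exact: sq_eq0.
by have := mumax v; rewrite vG dotZl -sqE ler_pM2r.
Qed.

Lemma max_singular_value_ge0 N (A : 'M[R]_N) : (0 < N)%N -> 0 <= max_singular_value A.
Proof.
by move=> /(max_singular_value_rayleigh A)[mu + _]; apply: le_trans; exact: sqrtr_ge0.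
Qed.

(** The Rayleigh bound is applied to each column, and the squared Frobenius norm adds over
    columns. *)
Lemma sq_mulmx_le N n (A : 'M[R]_N) (Z : 'M[R]_(N, n)) : (0 < N)%N ->
  sq (A *m Z) <= max_singular_value A ^+ 2 * sq Z.
Proof.
move=> N0; have [mu sup_ge mumax] := max_singular_value_rayleigh A N0.
have mu_le : mu <= max_singular_value A ^+ 2.
  (* [Num.sqrt] is 0 on negative numbers, so the sign of [mu] is split before squaring back. *)
  have [mu0|mu0] := leP 0 mu; last by rewrite (le_trans (ltW mu0))// sqr_ge0.
  by rewrite -(sqr_sqrtr mu0) ler_sqr// nnegrE ?(le_trans _ sup_ge) ?sqrtr_ge0.
rewrite !sq_cols mulr_sumr; apply: ler_sum => j _.
have -> : col j (A *m Z) = A *m (col j Z)^T^T by rewrite trmxK !colE mulmxA.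
rewrite sq_mulmx_tr -[in leRHS]sq_tr.
by apply: le_trans (mumax _) _; rewrite ler_wpM2r// sq_ge0.
Qed.

End more_frobenius.

(** * Descent lemma and averaging *)

Section descent.
Context (R : realType) (p : nat).
Implicit Types (h : 'rV[R]_p -> R) (y d : 'rV[R]_p).

Lemma dot_gradient h y d : differentiable h y -> 'D_d h y = dot (gradient h y) d.
Proof.
move=> dh; rewrite deriveE// {1}[d]row_sum_delta raddf_sum /dot big_ord1.
apply: eq_bigr => j _; rewrite mxE deriveE// mulrC.
exact: (linearZ_LR ('d h y) (d 0 j) (delta_mx 0 j)).
Qed.

Lemma is_derive_line h y d (t : R) : (forall z, differentiable h z) ->
  is_derive t (1 : R) (fun s : R => h (y + s *: d)) (dot (gradient h (y + t *: d)) d).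
Proof.
move=> dh.
have E : (fun s : R => s^-1 *: (((fun s : R => h (y + s *: d)) \o shift t) (s *: (1 : R)) -
    h (y + t *: d))) =
  (fun s : R => s^-1 *: ((h \o shift (y + t *: d)) (s *: d) - h (y + t *: d))).
  apply/funext => s /=; congr (_ *: (h _ - _)).
  by rewrite [s *: 1]mulr1 scalerDl addrCA.
have dd := diff_derivable (v := d) (dh (y + t *: d)).
apply: DeriveDef; first by rewrite /derivable E.
by rewrite /derive E -dot_gradient.
Qed.

Lemma is_derive_quadratic (a c t : R) :
  is_derive t (1 : R) (fun s : R => a * s + c * s ^+ 2) (a + 2 * c * t).
Proof.
have dX := is_deriveX 2 (is_derive_id t (1 : R)).
have dq := is_deriveD (is_deriveZ a (is_derive_id t (1 : R))) (is_deriveZ c dX).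
have -> : a + 2 * c * t = a *: (1 : R) + c *: ((2%:R * id t ^+ 1) *: (1 : R)).
  by rewrite /GRing.scale /= expr1 !mulr1; ring.
exact: dq.
Qed.

(** A root-free Cauchy-Schwarz, from [0 <= |A - c B|^2]. *)
Lemma dot_le_sq n m (A B : 'M[R]_(n, m)) c : 0 < c ->
  sq A <= c ^+ 2 * sq B -> dot A B <= c * sq B.
Proof.
move=> c0 AB; have := sq_ge0 (A - c *: B); rewrite sqB sqZ dotZr => H.
have : c * (2 * dot A B) <= c * (2 * (c * sq B)) by nra.
by rewrite ler_pM2l// ler_pM2l.
Qed.

(** Integration is avoided: [g] is [h] along the segment minus the claimed quadratic upper model,
    its derivative is nonpositive on [(0, 1)] by the Lipschitz bound, and the mean value theorem
    gives [g 1 <= g 0]. *)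
Lemma descent_le h L y z : 0 < L -> (forall x, differentiable h x) ->
  (forall x x', sq (gradient h x - gradient h x') <= L ^+ 2 * sq (x - x')) ->
  h z <= h y + dot (gradient h y) (z - y) + L / 2 * sq (z - y).
Proof.
move=> L0 dh hL; set d := z - y.
pose a := dot (gradient h y) d.
pose g (t : R) := h (y + t *: d) - (a * t + L / 2 * sq d * t ^+ 2).
pose dg (t : R) := dot (gradient h (y + t *: d)) d - (a + L * sq d * t).
have gder t : is_derive t (1 : R) g (dg t).
  apply: is_deriveB; first exact: is_derive_line.
  have -> : a + L * sq d * t = a + 2 * (L / 2 * sq d) * t by field.
  exact: is_derive_quadratic.
have gcont : {within `[0, 1], continuous g}.
  apply: continuous_subspaceT => t; apply: differentiable_continuous.
  by apply/derivable1_diffP; have [] := gder t.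
have [c] := MVT ltr01 (fun x _ => gder x) gcont.
rewrite in_itv /= subr0 mulr1 => /andP[c0 c1] gE.
have dg0 : dg c <= 0.
  rewrite /dg /a opprD addrA -dotNl -dotDl subr_le0.
  have := @dot_le_sq _ _ (gradient h (y + c *: d) - gradient h y) d (L * c) (mulr_gt0 L0 c0).
  move=> H; rewrite mulrAC; apply: H.
  have := hL (y + c *: d) y. rewrite (_ : y + c *: d - y = c *: d) ?sqZ ?exprMn ?mulrA//.
  by rewrite addrC addKr.
have : g 1 - g 0 <= 0 by rewrite gE.
have yd : y + d = z by rewrite addrC subrK.
rewrite /g scale1r scale0r addr0 yd expr1n expr0n /= -/a.
by lra.
Qed.

End descent.

Section consensus.
Context (R : realType) (N p : nat).
Hypothesis N0 : (0 < N)%N.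
Implicit Types (Y : 'M[R]_(N, p)) (u : 'rV[R]_p).

Let NR : (N%:R : R) != 0. Proof. by rewrite pnatr_eq0 -lt0n. Qed.

Definition avg_mx : 'M[R]_N := N%:R^-1 *: (ones R N *m (ones R N)^T).

Definition dev Y : 'M[R]_(N, p) := Y - ones R N *m mean_row Y.

Lemma mean_rowE Y : mean_row Y = N%:R^-1 *: ((ones R N)^T *m Y).
Proof.
congr (_ *: _); apply/rowP => j; rewrite summxE mxE; apply: eq_bigr => n _.
by rewrite !mxE mul1r.
Qed.

Lemma mean_rowD Y Y' : mean_row (Y + Y') = mean_row Y + mean_row Y'.
Proof. by rewrite !mean_rowE mulmxDr scalerDr. Qed.

Lemma mean_rowZ a Y : mean_row (a *: Y) = a *: mean_row Y.
Proof. by rewrite !mean_rowE -scalemxAr !scalerA mulrC. Qed.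

Lemma mean_rowN Y : mean_row (- Y) = - mean_row Y.
Proof. by rewrite -scaleN1r mean_rowZ scaleN1r. Qed.

Lemma ones_tr_ones : (ones R N)^T *m ones R N = (N%:R)%:M.
Proof.
apply/matrixP => i j; rewrite !ord1 mxE mxE eqxx mulr1n.
rewrite (eq_bigr (fun=> 1)) => [|k _]; last by rewrite !mxE mulr1.
by rewrite sumr_const card_ord.
Qed.

Lemma mean_row_ones u : mean_row (ones R N *m u) = u.
Proof. by rewrite mean_rowE mulmxA ones_tr_ones mul_scalar_mx scalerA mulVf// scale1r. Qed.

Lemma avg_mxE Y : avg_mx *m Y = ones R N *m mean_row Y.
Proof. by rewrite /avg_mx mean_rowE -scalemxAl -scalemxAr mulmxA. Qed.

Lemma devE Y : dev Y = Y - avg_mx *m Y.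
Proof. by rewrite avg_mxE. Qed.

Lemma devD Y Y' : dev (Y + Y') = dev Y + dev Y'.
Proof. by rewrite !devE mulmxDr opprD addrACA. Qed.

Lemma devZ a Y : dev (a *: Y) = a *: dev Y.
Proof. by rewrite !devE -scalemxAr scalerBr. Qed.

Lemma devN Y : dev (- Y) = - dev Y.
Proof. by rewrite -scaleN1r devZ scaleN1r. Qed.

Lemma dev_ones u : dev (ones R N *m u) = 0.
Proof. by rewrite /dev mean_row_ones subrr. Qed.

Lemma dot_mulmx_ones Y u : dot (ones R N *m u) Y = N%:R * dot u (mean_row Y).
Proof.
rewrite mean_rowE dotZr mulrA mulfV// mul1r /dot big_ord1 exchange_big.
apply: eq_bigr => j _; rewrite mxE mulr_sumr; apply: eq_bigr => n _.
by rewrite !mxE big_ord1 !mxE !mul1r.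
Qed.

Lemma sq_ones u : sq (ones R N *m u) = N%:R * sq u.
Proof. by rewrite !sqE dot_mulmx_ones mean_row_ones. Qed.

Lemma mean_row_dev Y : mean_row (dev Y) = 0.
Proof. by rewrite /dev mean_rowD mean_rowN mean_row_ones subrr. Qed.

(** Pythagoras: the deviation has mean zero and is therefore orthogonal to all consensus
    matrices. *)
Lemma sq_dev Y : sq Y = sq (dev Y) + N%:R * sq (mean_row Y).
Proof.
rewrite -[in LHS](subrK (ones R N *m mean_row Y) Y) -/(dev Y) sqD dotC dot_mulmx_ones.
by rewrite mean_row_dev -(scale0r (mean_row Y)) dotZr mul0r !mulr0 addr0 sq_ones.
Qed.

Lemma sq_dev_le Y : sq (dev Y) <= sq Y.
Proof. by rewrite [leRHS]sq_dev lerDl mulr_ge0// sq_ge0. Qed.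

Lemma sq_mean_row_le Y : N%:R * sq (mean_row Y) <= sq Y.
Proof. by rewrite [leRHS]sq_dev lerDr sq_ge0. Qed.

Variables (e : rel 'I_N) (W : 'M[R]_N).
Hypothesis hW : mixing_matrix e W.

Lemma mean_row_mix Y : mean_row (W *m Y) = mean_row Y.
Proof. by case: hW => _ _ _ W1; rewrite !mean_rowE mulmxA W1. Qed.

Lemma mix_avg_mx : W *m avg_mx = avg_mx.
Proof. by case: hW => _ _ W1 _; rewrite /avg_mx -scalemxAr mulmxA W1. Qed.

Lemma mix_split Y : W *m Y = (W - avg_mx) *m dev Y + ones R N *m mean_row Y.
Proof.
rewrite mulmxBl avg_mxE mean_row_dev mulmx0 subr0 devE mulmxBr mulmxA mix_avg_mx avg_mxE.
by rewrite subrK.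
Qed.

Lemma dev_mix Y : dev (W *m Y) = (W - avg_mx) *m dev Y.
Proof.
by rewrite mulmxBl avg_mxE mean_row_dev mulmx0 subr0 [in LHS]/dev mean_row_mix
  devE mulmxBr mulmxA mix_avg_mx avg_mxE.
Qed.

Lemma sq_contract Y : sq ((W - avg_mx) *m Y) <= lambda_w W ^+ 2 * sq Y.
Proof. exact: sq_mulmx_le. Qed.

End consensus.

(** * One communication round *)

Lemma sq_contractD (R : realType) m n (lam a : R) (A B : 'M[R]_(m, n)) :
  0 < lam ^+ 2 -> lam ^+ 2 < 1 -> 0 <= a -> sq A <= lam ^+ 2 * a ->
  sq (A + B) <= (1 - (1 - lam ^+ 2) / 2) * a + 2 / (1 - lam ^+ 2) * sq B.
Proof.
set s := lam ^+ 2 => s0 s1 a0 Aa.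
have d0 : 0 < 1 - s by rewrite subr_gt0.
(* This Young parameter makes [(1 + t) s = 1 - (1 - s) / 2], so half of the contraction gap
   survives, while [1 + 1 / t = (1 + s) / (1 - s)] is at most [2 / (1 - s)]. *)
have t0 : 0 < (1 - s) / (2 * s) by rewrite divr_gt0// mulr_gt0.
apply: le_trans (sqD_young A B t0) _; apply: lerD.
  apply: le_trans (ler_wpM2l _ Aa) _; first by rewrite addr_ge0// ltW.
  rewrite mulrA ler_wpM2r// le_eqVlt; apply/orP; left; apply/eqP; field.
  exact: lt0r_neq0.
rewrite ler_wpM2r ?sq_ge0// -subr_ge0.
have -> : 2 / (1 - s) - (1 + ((1 - s) / (2 * s))^-1) = 1.
  by field; rewrite !lt0r_neq0.
exact: ler01.
Qed.

Section local_round.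
Context (R : realType) (N p E : nat) (e : rel 'I_N) (W : 'M[R]_N).
Hypothesis N0 : (0 < N)%N.
Hypothesis hW : mixing_matrix e W.
Hypothesis E0 : (0 < E)%N.
Variables (gamma L : R).
Let lam := lambda_w W.
Let delta := 1 - lam ^+ 2.
Let eps := gamma * L * E%:R.
Hypothesis lam0 : 0 < lam ^+ 2.
Hypothesis lam1 : lam ^+ 2 < 1.
Hypothesis gamma0 : 0 < gamma.
Hypothesis L0 : 0 < L.
Hypothesis eps_small : eps <= delta ^+ 2 / 720.
Variable D : 'M[R]_(N, p) -> 'M[R]_(N, p).
Hypothesis D_lip : forall A B, sq (D A - D B) <= L ^+ 2 * sq (A - B).
Variables (x g : nat -> 'M[R]_(N, p)) (v : 'M[R]_(N, p)).
Hypothesis x_local : forall q, (0 < q <= E)%N ->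
  x q = W *m x 0%N - (gamma * q%:R) *: (W *m v) -
        gamma *: \sum_(0 <= j < q) (g j - g 0%N).
Hypothesis v_mean : mean_row v = mean_row (g 0%N).

Let n j := g j - D (x j).
Let h q := mean_row (D (x q)).
Let Y := sq (dev (x 0%N)).
(** Noise budget of a round: the increments [n j - n 0] give [2 E] times the sum plus
    [2 E^2 |n 0|^2], and the noise in the mean of [g 0] gives the other [2 E^2 |n 0|^2]. *)
Let nu := 2 * E%:R * (\sum_(0 <= j < E) sq (n j)) + 4 * E%:R ^+ 2 * sq (n 0%N).

(* By [x_rest] below, [x q] is the mixed iterate minus [rest q], and
   [round_slack] bounds the squared norm of [rest q] up to a factor 4.1 and a
   negligible multiple of the consensus error. *)
Definition round_slack : R := (gamma * E%:R) ^+ 2 * sq (dev v) +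
  2 * (gamma * E%:R) ^+ 2 * N%:R * sq (h 0%N) + gamma ^+ 2 * nu.
Let Z := round_slack.

(** The four summands are the mixed tracking error, the mean direction, the change of the true
    gradients and the change of the noise. *)
Let rest q := ((gamma * q%:R) *: ((W - avg_mx R N) *m dev v) +
   (gamma * q%:R) *: (ones R N *m mean_row (g 0%N))) +
  (gamma *: (\sum_(0 <= j < q) (D (x j) - D (x 0%N))) +
   gamma *: (\sum_(0 <= j < q) (n j - n 0%N))).

Let gLE0 : 0 <= gamma ^+ 2 * L ^+ 2 * E%:R.
Proof. exact: mulr_ge0 (mulr_ge0 (sqr_ge0 _) (sqr_ge0 _)) (ler0n _ _). Qed.

Let delta0 : 0 < delta. Proof. by rewrite subr_gt0. Qed.

Let delta1 : delta <= 1. Proof. by rewrite lerBlDr lerDl ltW. Qed.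

Let eps0 : 0 < eps. Proof. by rewrite !mulr_gt0// ltr0n. Qed.

Let eps1 : eps ^+ 2 <= (1 / 720) ^+ 2.
Proof.
have e1 : eps <= 1 / 720.
  have d2 : delta ^+ 2 <= 1 by rewrite expr_le1// ltW.
  by apply: le_trans eps_small _; lra.
by rewrite ler_sqr// nnegrE; [exact: ltW|lra].
Qed.

Let nu0 : 0 <= nu.
Proof.
have s0 : 0 <= \sum_(0 <= j < E) sq (n j) by apply: sumr_ge0 => j _; exact: sq_ge0.
have H1 := mulr_ge0 (ler0n R E) s0.
have := mulr_ge0 (sqr_ge0 E%:R) (sq_ge0 (n 0%N)); rewrite /nu; lra.
Qed.

Lemma round_slack_ge0 : 0 <= Z.
Proof.
rewrite /Z /round_slack.
have a0 := sqr_ge0 (gamma * E%:R).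
have b0 := mulr_ge0 a0 (sq_ge0 (dev v)).
have c0 := mulr_ge0 (mulr_ge0 a0 (ler0n R N)) (sq_ge0 (h 0%N)).
have := mulr_ge0 (sqr_ge0 gamma) nu0; lra.
Qed.

Let x_rest q : (0 < q <= E)%N ->
  x q = (W - avg_mx R N) *m dev (x 0%N) + ones R N *m mean_row (x 0%N) - rest q.
Proof.
move=> qE; rewrite x_local// (mix_split N0 hW) (mix_split N0 hW v) v_mean -!addrA.
congr (_ + (_ + _)); rewrite /rest -opprD; congr (- _).
rewrite scalerDr -!addrA; congr (_ + (_ + _)).
rewrite -scalerDr -big_split; congr (_ *: _); apply: eq_bigr => j _ /=.
by rewrite /n opprB addrACA subrKC addKr.
Qed.

Let S := \sum_(0 <= j < E) sq (x j - x 0%N).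

Let S_ge0 : 0 <= S.
Proof. by apply: sumr_ge0 => j _; exact: sq_ge0. Qed.

Let sum_widen (F : nat -> R) q : (q <= E)%N -> (forall j, 0 <= F j) ->
  q%:R * (\sum_(0 <= j < q) F j) <= E%:R * (\sum_(0 <= j < E) F j).
Proof.
move=> qE F0; have F0' k : 0 <= \sum_(0 <= j < k) F j by apply: sumr_ge0.
apply: ler_pM => //; first by rewrite ler_nat.
by rewrite [leRHS](big_cat_nat (n := q))//= lerDl; apply: sumr_ge0.
Qed.

Let rest_bound q : (q <= E)%N ->
  sq (rest q) <= 4 * (Z + gamma ^+ 2 * L ^+ 2 * E%:R * S).
Proof.
move=> qE.
have qE2 : (gamma * q%:R) ^+ 2 <= (gamma * E%:R) ^+ 2.
  by rewrite ler_sqr ?nnegrE ?mulr_ge0 ?ler_wpM2l ?ler_nat// ltW.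
have Ha : sq ((gamma * q%:R) *: ((W - avg_mx R N) *m dev v)) <=
    (gamma * E%:R) ^+ 2 * sq (dev v).
  rewrite sqZ; apply: ler_pM => //; rewrite ?sqr_ge0 ?sq_ge0//.
  apply: le_trans (sq_contract N0 W _) _.
  by rewrite -[leRHS]mul1r ler_wpM2r ?sq_ge0// ltW.
have Hb : sq ((gamma * q%:R) *: (ones R N *m mean_row (g 0%N))) <=
    (gamma * E%:R) ^+ 2 * (2 * N%:R * sq (h 0%N) + 2 * sq (n 0%N)).
  rewrite sqZ; apply: ler_pM => //; rewrite ?sqr_ge0 ?sq_ge0//.
  have -> : g 0%N = D (x 0%N) + n 0%N by rewrite addrC subrK.
  rewrite (sq_ones N0) mean_rowD -/(h 0%N).
  have H1 := sqD_le2 (h 0%N) (mean_row (n 0%N)).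
  have H2 := sq_mean_row_le N0 (n 0%N).
  have : N%:R * sq (h 0%N + mean_row (n 0%N)) <= N%:R * (2 * (sq (h 0%N) + sq (mean_row (n 0%N)))).
    by rewrite ler_wpM2l.
  lra.
have Hc : sq (gamma *: (\sum_(0 <= j < q) (D (x j) - D (x 0%N)))) <=
    gamma ^+ 2 * L ^+ 2 * E%:R * S.
  have -> : gamma ^+ 2 * L ^+ 2 * E%:R * S = gamma ^+ 2 * (E%:R * (L ^+ 2 * S)) by ring.
  rewrite sqZ; apply: ler_wpM2l; first exact: sqr_ge0.
  apply: le_trans (sq_sum _ _) _.
  apply: le_trans (sum_widen qE (fun j => sq_ge0 _)) _.
  apply: ler_wpM2l => //; rewrite mulr_sumr.
  by apply: ler_sum => j _; exact: D_lip.
have Hd : sq (gamma *: (\sum_(0 <= j < q) (n j - n 0%N))) <=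
    gamma ^+ 2 * (2 * E%:R * (\sum_(0 <= j < E) sq (n j)) + 2 * E%:R ^+ 2 * sq (n 0%N)).
  rewrite sqZ; apply: ler_wpM2l; first exact: sqr_ge0.
  apply: le_trans (sq_sum _ _) _.
  apply: le_trans (sum_widen qE (fun j => sq_ge0 _)) _.
  have : \sum_(0 <= j < E) sq (n j - n 0%N) <= \sum_(0 <= j < E) (2 * (sq (n j) + sq (n 0%N))).
    by apply: ler_sum => j _; apply: le_trans (sqD_le2 _ _) _; rewrite sqN.
  rewrite -mulr_sumr big_split /= sumr_const_nat subn0 -mulr_natl => H.
  have := ler_wpM2l (ler0n R E) H; rewrite expr2; lra.
have H1 := sqD_le2 ((gamma * q%:R) *: ((W - avg_mx R N) *m dev v))
   ((gamma * q%:R) *: (ones R N *m mean_row (g 0%N))).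
have H2 := sqD_le2 (gamma *: (\sum_(0 <= j < q) (D (x j) - D (x 0%N))))
   (gamma *: (\sum_(0 <= j < q) (n j - n 0%N))).
(* Halving the sum of four terms twice costs the factor 4. *)
apply: le_trans (sqD_le2 _ _) _.
rewrite /Z /round_slack /nu; move: Ha Hb Hc Hd H1 H2.
set ga := sq _; set gb := sq (_ *: (_ *m _)); set gc := sq (gamma *: _); set gd := sq (gamma *: _).
rewrite !exprMn.
lra.
Qed.

Let A_bound0 q : (q <= E)%N ->
  sq (x q - x 0%N) <= 8 * Y + 8 * (Z + gamma ^+ 2 * L ^+ 2 * E%:R * S).
Proof.
case: q => [|q] qE.
  rewrite subrr sq0.
  have H1 := mulr_ge0 gLE0 S_ge0.
  have := round_slack_ge0; have := sq_ge0 (dev (x 0%N)); rewrite -/Y; lra.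
have := rest_bound qE; set r := rest _ => Hr.
rewrite x_rest// -/r.
set a := (W - avg_mx R N) *m dev (x 0%N).
have -> : a + ones R N *m mean_row (x 0%N) - r - x 0%N = (a - dev (x 0%N)) - r.
  by rewrite /dev opprB addrA [RHS]addrAC.
apply: le_trans (sqD_le2 _ _) _; rewrite sqN.
have H1 := sqD_le2 a (- dev (x 0%N)); rewrite sqN in H1.
have H2 : sq a <= sq (dev (x 0%N)).
  apply: le_trans (sq_contract N0 W _) _.
  by rewrite -[leRHS]mul1r ler_wpM2r ?sq_ge0// ltW.
rewrite /Y; lra.
Qed.

(** The drift sum [S] occurs on both sides; its coefficient [8 eps^2] is at most [8 / 720^2], and
    absorbing it raises the constant 8 to 8.1. *)
Let S_bound : S <= 81 / 10 * E%:R * (Y + Z).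
Proof.
have : S <= \sum_(0 <= j < E) (8 * Y + 8 * (Z + gamma ^+ 2 * L ^+ 2 * E%:R * S)).
  by apply: ler_sum_nat => j /andP[_ /ltnW]; exact: A_bound0.
rewrite sumr_const_nat subn0 -[leRHS]mulr_natl.
have -> : E%:R * (8 * Y + 8 * (Z + gamma ^+ 2 * L ^+ 2 * E%:R * S)) =
  8 * E%:R * (Y + Z) + 8 * (eps ^+ 2 * S) by rewrite /eps; ring.
have := ler_wpM2r S_ge0 eps1.
have : 0 <= E%:R * (Y + Z).
  by rewrite mulr_ge0// addr_ge0// ?round_slack_ge0// sq_ge0.
lra.
Qed.

Let epsS : gamma ^+ 2 * L ^+ 2 * E%:R * S <= 81 / 10 * eps ^+ 2 * (Y + Z).
Proof.
have -> : 81 / 10 * eps ^+ 2 * (Y + Z) = gamma ^+ 2 * L ^+ 2 * E%:R * (81 / 10 * E%:R * (Y + Z)).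
  by rewrite /eps; ring.
exact: ler_wpM2l gLE0 _ _ S_bound.
Qed.

Let Y0 : 0 <= Y. Proof. exact: sq_ge0. Qed.
Let Z0 : 0 <= Z. Proof. exact: round_slack_ge0. Qed.

Let U_bound q : (q <= E)%N -> sq (rest q) <= 41 / 10 * Z + 36 * eps ^+ 2 * Y.
Proof.
move=> /rest_bound; have := epsS; have := ler_wpM2r Z0 eps1; have := Z0.
have := mulr_ge0 (sqr_ge0 eps) Y0; lra.
Qed.

Lemma round_drift q : (q <= E)%N -> sq (x q - x 0%N) <= 81 / 10 * (Y + Z).
Proof.
move=> /A_bound0; have := epsS; have := ler_wpM2r Z0 eps1; have := ler_wpM2r Y0 eps1.
have := Z0; have := Y0.
lra.
Qed.

Let dev_x q : (0 < q <= E)%N -> dev (x q) = (W - avg_mx R N) *m dev (x 0%N) - dev (rest q).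
Proof.
move=> qE; rewrite x_rest// devD devN devD (dev_ones N0) addr0; congr (_ - _).
by rewrite -(dev_mix N0 hW) devE avg_mxE mean_row_dev// mulmx0 subr0.
Qed.

Lemma round_consensus q : (q <= E)%N -> sq (dev (x q)) <= 21 / 10 * Y + 82 / 10 * Z.
Proof.
case: q => [_|q qE]; first by rewrite -/Y; have := Y0; have := Z0; lra.
rewrite dev_x//; apply: le_trans (sqD_le2 _ _) _; rewrite sqN.
have H1 := sq_dev_le N0 (rest q.+1); have H2 := U_bound qE.
have H3 : sq ((W - avg_mx R N) *m dev (x 0%N)) <= Y.
  apply: le_trans (sq_contract N0 W _) _.
  by rewrite -[leRHS]mul1r ler_wpM2r ?sq_ge0// ltW.
have := ler_wpM2r Y0 eps1; have := Z0; have := Y0; lra.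
Qed.

(** [round_consensus] spends the contraction and loses a factor 2, which is harmless inside a round;
    the recursion between rounds needs a factor below 1. *)
Lemma round_consensus_contract :
  sq (dev (x E)) <= (1 - delta / 2) * Y + 2 / delta * (41 / 10 * Z + 36 * eps ^+ 2 * Y).
Proof.
have EE : (0 < E <= E)%N by rewrite E0 leqnn.
rewrite (dev_x EE).
apply: le_trans (sq_contractD _ lam0 lam1 Y0 (sq_contract N0 W _)) _.
rewrite lerD2l; apply: ler_wpM2l; first by rewrite divr_ge0// ltW.
by rewrite sqN; apply: le_trans (sq_dev_le N0 _) _; exact: U_bound.
Qed.

Lemma round_tracking_contract :
  sq (dev (W *m v + g E - g 0%N)) <= (1 - delta / 2) * sq (dev v) +
    2 / delta * (162 / 10 * L ^+ 2 * (Y + Z) + 4 * (sq (n E) + sq (n 0%N))).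
Proof.
rewrite -addrA devD (dev_mix N0 hW).
apply: le_trans (sq_contractD _ lam0 lam1 (sq_ge0 _) (sq_contract N0 W _)) _.
rewrite lerD2l; apply: ler_wpM2l; first by rewrite divr_ge0// ltW.
apply: le_trans (sq_dev_le N0 _) _.
have -> : g E - g 0%N = (D (x E) - D (x 0%N)) + (n E - n 0%N).
  by rewrite /n opprB addrACA subrKC addKr.
apply: le_trans (sqD_le2 _ _) _.
have H1 := D_lip (x E) (x 0%N).
have H2 := sqD_le2 (n E) (- n 0%N); rewrite sqN in H2.
have := ler_wpM2l (sqr_ge0 L) (round_drift (leqnn E)).
lra.
Qed.

(** Converts descent at a local update into descent measured at the round start: Young with
    [t = 1/2], multiplied by [2/3], gives [2/3 |h 0|^2 <= |h q|^2 + 2 |h q - h 0|^2]. *)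
Lemma round_gradient q : (q <= E)%N ->
  2 / 3 * sq (h 0%N) - 2 * (L ^+ 2 / N%:R * (81 / 10 * (Y + Z))) <= sq (h q).
Proof.
move=> qE.
have NR : 0 < (N%:R : R) by rewrite ltr0n.
have H1 : sq (h q - h 0%N) <= L ^+ 2 / N%:R * (81 / 10 * (Y + Z)).
  rewrite mulrAC ler_pdivlMr// mulrC /h -mean_rowN -mean_rowD.
  apply: le_trans (sq_mean_row_le N0 _) _; apply: le_trans (D_lip _ _) _.
  by rewrite ler_wpM2l ?sqr_ge0//; exact: round_drift.
have half0 : 0 < (2^-1 : R) by rewrite invr_gt0.
have := sqD_young (h q) (h 0%N - h q) half0; rewrite subrKC.
rewrite invrK -(sqN (h 0%N - h q)) opprB; lra.
Qed.

End local_round.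

(** * Sums over rounds *)

Lemma contraction_sum (R : realType) (a b : nat -> R) (delta : R) T :
  0 < delta -> (forall r, 0 <= a r) ->
  (forall r, (r < T)%N -> a r.+1 <= (1 - delta / 2) * a r + 2 / delta * b r) ->
  delta ^+ 2 * (\sum_(0 <= r < T) a r) <= 2 * delta * a 0%N + 4 * \sum_(0 <= r < T) b r.
Proof.
move=> d0 a0 rec.
(* The extra [2 * a T] makes the induction go through: it absorbs the new term [a T] of the sum and
   is dropped at the end. *)
suff H : delta * (delta * \sum_(0 <= r < T) a r + 2 * a T) <=
    2 * delta * a 0%N + 4 * \sum_(0 <= r < T) b r.
  by have := mulr_ge0 (ltW d0) (a0 T); lra.
elim: T rec => [|T IH] rec; first by rewrite !big_geq//; lra.
rewrite !big_nat_recr//=.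
have := IH (fun r rT => rec r (ltnW rT)).
have := ler_wpM2l (ltW d0) (rec T (ltnSn T)).
have -> : delta * ((1 - delta / 2) * a T + 2 / delta * b T) =
  delta * a T - delta * (delta * a T) / 2 + 2 * b T.
  by field; exact: lt0r_neq0.
lra.
Qed.

(* [Sy], [Sw], [Sk] are the sums over the rounds of the consensus errors, of the
   tracking errors scaled by [(gamma E)^2] and of the gradient norms scaled by
   [(gamma E)^2 N]; [Sn] and [Sm] collect the noise.  The bound solves the two
   coupled inequalities. *)
Lemma tracking_sums (R : realType) (delta eps Sy Sw Sk Sn Sm w0 : R) :
  0 < delta -> delta <= 1 -> 0 < eps -> eps <= delta ^+ 2 / 720 ->
  0 <= Sy -> 0 <= Sw -> 0 <= Sk -> 0 <= Sn -> 0 <= Sm -> 0 <= w0 ->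
  delta ^+ 2 * Sy <= 4 * (41 / 10 * (Sw + 2 * Sk + Sn) + 36 * eps ^+ 2 * Sy) ->
  delta ^+ 2 * Sw <= 2 * delta * w0 +
    4 * (162 / 10 * eps ^+ 2 * (Sy + (Sw + 2 * Sk + Sn)) + 4 * Sm) ->
  91 / 10 * Sy + 122 / 10 * (Sw + 2 * Sk + Sn) <=
    (350 * w0 + 2700 * Sm + 180 * Sn) / delta ^+ 4 + 1000 * (Sk / delta ^+ 2).
Proof.
move=> d0 d1 e0 es Sy0 Sw0 Sk0 Sn0 Sm0 w00 Hy Hw.
pose u := delta ^+ 2.
have u0 : 0 < u by rewrite exprn_gt0.
have u1 : u <= 1 by rewrite expr_le1// ltW.
have u20 : 0 < u ^+ 2 by rewrite exprn_gt0.
have uu a : 0 <= a -> u * a <= a by move=> a0; rewrite -[leRHS]mul1r ler_wpM2r.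
have e2 : eps ^+ 2 <= u ^+ 2 * (1 / 720) ^+ 2.
  have eu : eps <= u * (1 / 720) by move: es; rewrite -/u; lra.
  have u720 : 0 <= u * (1 / 720) by lra.
  by rewrite -exprMn ler_sqr ?nnegrE ?u720 ?(ltW e0).
have ea a : 0 <= a -> eps ^+ 2 * a <= (1 / 720) ^+ 2 * (u * (u * a)).
  by move=> a0; apply: le_trans (ler_wpM2r a0 e2) _; rewrite expr2; lra.
have uge a : 0 <= a -> 0 <= u * a by move=> a0; rewrite mulr_ge0// ltW.
have -> : 1000 * (Sk / delta ^+ 2) = 1000 * (u * Sk) / u ^+ 2.
  by rewrite /u; field; exact: lt0r_neq0.
have -> : delta ^+ 4 = u ^+ 2 by rewrite -exprM.
rewrite -mulrDl ler_pdivlMr// mulrC.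
(* Inserting the second inequality into the first, with [9.1 * 16.4] about 149.3, gives leading
   coefficients of about 323 for [w0], 2583 for [Sm], 162 for [Sn] and 323 for [Sk]; the stated
   constants leave room for the [eps] terms. After multiplication by [u ^+ 2] all is linear in the
   products of powers of [u] with the sums. *)
have Hy' := ler_wpM2l (ltW u0) Hy.
have dw : delta * w0 <= w0 by rewrite -[leRHS]mul1r ler_wpM2r.
move: Hy' Hw; rewrite -/u expr2 => Hy' Hw.
have h1 := ea _ Sy0; have h2 := ea _ Sw0; have h3 := ea _ Sk0; have h4 := ea _ Sn0.
have h5 := ler_wpM2l (ltW u0) h1.
have a1 := uu _ Sw0; have a2 := uu _ Sk0; have a3 := uu _ Sn0.
have b0 := uu _ (uge _ (uge _ Sy0)).
have b1 := uu _ (uge _ Sw0); have b2 := uu _ (uge _ Sk0); have b3 := uu _ (uge _ Sn0).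
have c1 := uge _ Sw0; have c2 := uge _ Sk0; have c0 := uge _ (uge _ Sy0).
lra.
Qed.

(** * The run as a single sequence of gradient evaluations *)

Section chain.
Context (R : realType) (N p E : nat) (W : 'M[R]_N) (gamma : R).
Variable G : nat -> nat -> 'M[R]_(N, p) -> 'M[R]_(N, p).
Variable Y0 : 'M[R]_(N, p).
Hypothesis E0 : (0 < E)%N.

(* Batch of the k-th gradient evaluation of the run: (0, 0) for k = 0, and local
   update q = 1, .., E of round r for k = r * E + q.  In particular the last
   gradient of a round is the first one used in the next round, and it is taken
   at the iterate before mixing. *)
Definition batch_index (k : nat) : nat * nat :=
  if k is k'.+1 then (k' %/ E, (k' %% E).+1)%N else (0, 0)%N.

(** One index replaces the nested loops, so measurability and integrability need a single induction;
    mixing happens in the steps that start at a multiple of [E]. *)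
Fixpoint chain (k : nat) : lsgt_state R N p :=
  if k is k'.+1 then
    let s := if (E %| k')%N then lsgt_mix W (chain k') else chain k' in
    lsgt_local_step gamma (G (batch_index k).1 (batch_index k).2) s
  else LsgtState Y0 (G 0%N 0%N Y0) (G 0%N 0%N Y0).

Lemma batch_index_round r q : (q < E)%N -> batch_index (r * E + q).+1 = (r, q.+1).
Proof. by move=> qE; rewrite /= divnMDl// divn_small// addn0 modnMDl modn_small. Qed.

Lemma lsgt_local_chain r q : (0 < q <= E)%N ->
  lsgt_local gamma (G r) (lsgt_mix W (chain (r * E))) q = chain (r * E + q).
Proof.
elim: q => // q IH /= qE.
rewrite addnS; move: (batch_index_round r qE) => [Hr Hq] /=.
rewrite Hr Hq dvdn_addr ?dvdn_mull//.
case: q IH qE {Hr Hq} => [|q] IH qE; first by rewrite dvdn0 addn0.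
by rewrite gtnNdvd// (IH (ltnW qE)).
Qed.

Lemma lsgt_chain r : lsgt W gamma E G Y0 r = chain (r * E).
Proof.
elim: r => [|r IH] //=.
by rewrite IH lsgt_local_chain ?E0 ?leqnn// mulSn addnC.
Qed.

Let x k := st_y (chain k).
Let v k := st_v (chain k).
Let g k := st_g (chain k).

Lemma chain_g k : g k = G (batch_index k).1 (batch_index k).2 (x k).
Proof. by case: k. Qed.

Lemma chain_xS k : x k.+1 = if (E %| k)%N then W *m x k - gamma *: (W *m v k)
                           else x k - gamma *: v k.
Proof. by rewrite /x /v /=; case: ifP. Qed.

Lemma chain_vS k : v k.+1 = (if (E %| k)%N then W *m v k else v k) + g k.+1 - g k.
Proof. by rewrite /v /g /=; case: ifP. Qed.

Lemma chain_v_round r q : (0 < q <= E)%N ->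
  v (r * E + q) = W *m v (r * E) + g (r * E + q) - g (r * E).
Proof.
elim: q => // q IH /= qE; rewrite addnS chain_vS dvdn_addr ?dvdn_mull//.
case: q IH qE => [|q] IH qE; first by rewrite dvdn0 addn0.
rewrite gtnNdvd// (IH (ltnW qE)).
by rewrite (addrAC (W *m _)) [X in X - _](addrAC (_ - _)) addrK addrAC.
Qed.

(** The tracking updates telescope inside a round, so each local direction is the mixed [v] plus a
    difference of two gradients; summing them gives the form assumed in the one-round analysis. *)
Lemma chain_x_round r q : (0 < q <= E)%N ->
  x (r * E + q) = W *m x (r * E) - (gamma * q%:R) *: (W *m v (r * E)) -
    gamma *: \sum_(0 <= j < q) (g (r * E + j) - g (r * E)).
Proof.
elim: q => // q IH /= qE; rewrite addnS chain_xS dvdn_addr ?dvdn_mull//.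
case: q IH qE => [|q] IH qE.
  by rewrite dvdn0 addn0 big_nat1 addn0 subrr scaler0 subr0 mulr1.
rewrite gtnNdvd// (IH (ltnW qE)) (chain_v_round r (ltnW qE : (0 < q.+1 <= E)%N)).
rewrite [in RHS]big_nat_recr//=.
rewrite -[q.+2]addn1 natrD mulrDr mulr1 scalerDl !scalerDr !opprD -!addrA.
by rewrite (addrCA (- (gamma *: \sum_(_ <= _ < _) _))).
Qed.

Section means.
Variable (e : rel 'I_N).
Hypothesis hW : mixing_matrix e W.

Lemma chain_mean_v k : mean_row (v k) = mean_row (g k).
Proof.
elim: k => [|k IH] //; rewrite chain_vS !mean_rowD mean_rowN.
have -> : mean_row (if (E %| k)%N then W *m v k else v k) = mean_row (g k).
  by case: ifP; rewrite ?(mean_row_mix hW).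
by rewrite addrC addKr.
Qed.

Lemma chain_mean_x k : mean_row (x k.+1) = mean_row (x k) - gamma *: mean_row (g k).
Proof.
rewrite chain_xS; case: ifP => _; rewrite mean_rowD mean_rowN mean_rowZ ?(mean_row_mix hW);
  by rewrite chain_mean_v.
Qed.

End means.
End chain.

(** The feedback of the gradient norms through the tracking error costs [1000 / 720^2], less than
    0.002, so [33/100] still leaves [1/4]. *)
Lemma pathwise_arith (R : realFieldType) (g c H Sy SZ F0 FT Flow M Q K : R) :
  Flow <= FT -> FT <= F0 - g * (33 / 100 * H - c * (91 / 10 * Sy + 122 / 10 * SZ)) + M ->
  g * c * (91 / 10 * Sy + 122 / 10 * SZ) <= g * c * (Q + 1000 * K) ->
  g * (c * K) <= g * ((1 / 720) ^+ 2 * H) -> 0 <= g * H ->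
  g / 4 * H <= F0 - Flow + M + g * c * Q.
Proof. lra. Qed.

(** Polarization: [- gF . h] is half of [|gF - h|^2 - |gF|^2 - |h|^2], and [|gF|^2] is discarded. *)
Lemma descent_step_arith (R : realFieldType) (gamma L F gFh gFm h hm m c dv gF : R) :
  0 <= gamma * gF -> gamma * (gF - 2 * gFh + h) <= gamma * (c * dv) ->
  F - gamma * (gFh + gFm) + L / 2 * (gamma ^+ 2 * (h + 2 * hm + m)) <=
  F - gamma / 2 * (1 - L * gamma) * h + gamma / 2 * c * dv +
    (- gamma * gFm + L * gamma ^+ 2 * hm + L * gamma ^+ 2 / 2 * m).
Proof. lra. Qed.

(** With [L gamma <= 1/100] the factor of [|h|^2] is at least 0.495; times [2/3] this is 0.33. The
    errors add up to [0.495 * 16.2 + 1.05 <= 9.1] for [Y] and [0.495 * 16.2 + 4.1 <= 12.2] for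
    [Z]. *)
Lemma local_descent_arith (R : realFieldType) (gamma L F h0 h c dv Y Z : R) :
  gamma * (2 / 3 * h0 - 2 * (c * (81 / 10 * (Y + Z)))) <= gamma * h ->
  gamma * c * dv <= gamma * c * (21 / 10 * Y + 82 / 10 * Z) ->
  gamma * h * (L * gamma) <= gamma * h * (1 / 100) ->
  0 <= gamma * c * Z -> 0 <= gamma * c * Y ->
  F - gamma / 2 * (1 - L * gamma) * h + gamma / 2 * c * dv <=
  F - gamma * (33 / 100 * h0 - c * (91 / 10 * Y + 122 / 10 * Z)).
Proof. lra. Qed.

(** * Descent of the averaged iterate *)

Section run.
Context (R : realType) (N p : nat).
Hypothesis N0 : (0 < N)%N.
Variables (f : 'I_N -> 'rV[R]_p -> R) (L : R).
Hypothesis L0 : 0 < L.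
Hypothesis fdiff : forall n y, differentiable (f n) y.
Hypothesis fL : forall n y y',
  norm2 (gradient (f n) y - gradient (f n) y') <= L * norm2 (y - y').

Definition grad_mx (Y : 'M[R]_(N, p)) : 'M[R]_(N, p) :=
  \matrix_(n < N) gradient (f n) (row n Y).

Let F := average_objective f.

Let NR : 0 < (N%:R : R). Proof. by rewrite ltr0n. Qed.

Lemma gradient_lip n y y' :
  sq (gradient (f n) y - gradient (f n) y') <= L ^+ 2 * sq (y - y').
Proof.
rewrite /sq -exprMn ler_sqr ?nnegrE; first exact: fL; first exact: sqrtr_ge0.
by rewrite mulr_ge0// ?sqrtr_ge0// ltW.
Qed.

Lemma grad_mx_lip A B : sq (grad_mx A - grad_mx B) <= L ^+ 2 * sq (A - B).
Proof.
rewrite !sq_rows mulr_sumr; apply: ler_sum => n _.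
by rewrite !raddfB /= !rowK gradient_lip.
Qed.

Lemma mean_grad_mx Y :
  mean_row (grad_mx Y) = N%:R^-1 *: \sum_(n < N) gradient (f n) (row n Y).
Proof. by congr (_ *: _); apply: eq_bigr => n _; rewrite rowK. Qed.

Lemma row_ones n (z : 'rV[R]_p) : row n (ones R N *m z) = z.
Proof. by apply/rowP => j; rewrite !mxE big_ord1 !mxE mul1r. Qed.

Lemma average_descent z z' :
  F z' <= F z + dot (mean_row (grad_mx (ones R N *m z))) (z' - z) + L / 2 * sq (z' - z).
Proof.
rewrite mean_grad_mx dotZl /F /average_objective.
have -> : dot (\sum_(n < N) gradient (f n) (row n (ones R N *m z))) (z' - z) =
    \sum_(n < N) dot (gradient (f n) z) (z' - z).
  rewrite (eq_bigr (fun n => gradient (f n) z)) => [|n _]; last by rewrite row_ones.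
  elim/big_rec2: _ => [|n a b _ <-]; last by rewrite dotDl.
  by rewrite -(scale0r 0) dotZl mul0r.
have -> : L / 2 * sq (z' - z) = N%:R^-1 * \sum_(n < N) (L / 2 * sq (z' - z)).
  by rewrite sumr_const card_ord -(mulr_natl (L / 2 * _) N) mulKf// lt0r_neq0.
rewrite -!mulrDr ler_wpM2l ?invr_ge0// -!big_split; apply: ler_sum => n _.
by apply: (@descent_le _ _ _ L) => //; exact: gradient_lip.
Qed.

(** The mean of the agents' gradients [h] differs from the gradient of [F] at the mean by at most
    the consensus error; the noise [m] is kept exactly, in the last summand. *)
Lemma descent_step gamma (Y : 'M[R]_(N, p)) (m z' : 'rV[R]_p) : 0 < gamma ->
  let z := mean_row Y in let h := mean_row (grad_mx Y) in
  z' = z - gamma *: (h + m) ->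
  F z' <= F z - gamma / 2 * (1 - L * gamma) * sq h
    + gamma / 2 * (L ^+ 2 / N%:R) * sq (dev Y)
    + (- gamma * dot (mean_row (grad_mx (ones R N *m z))) m
       + L * gamma ^+ 2 * dot h m + L * gamma ^+ 2 / 2 * sq m).
Proof.
move=> gamma0 z h z'E; apply: le_trans (average_descent z z') _.
have -> : z' - z = - (gamma *: (h + m)) by rewrite z'E addrAC subrr sub0r.
set gF := mean_row (grad_mx (ones R N *m z)).
rewrite sqN sqZ dotNr dotZr dotDr sqD.
have H : sq (gF - h) <= L ^+ 2 / N%:R * sq (dev Y).
  rewrite mulrAC ler_pdivlMr// mulrC /gF /h -mean_rowN -mean_rowD.
  apply: le_trans (sq_mean_row_le N0 _) _; apply: le_trans (grad_mx_lip _ _) _.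
  by rewrite -sqN opprB -/(dev Y).
have := ler_wpM2l (ltW gamma0) H; rewrite sqB => H'.
exact: (descent_step_arith L (F z) _ _ _ (mulr_ge0 (ltW gamma0) (sq_ge0 gF)) H').
Qed.

End run.

(** * The whole run for a fixed realization of the noise *)

Section pathwise.
Context (R : realType) (N p E T : nat) (e : rel 'I_N) (W : 'M[R]_N).
Hypothesis N0 : (0 < N)%N.
Hypothesis hW : mixing_matrix e W.
Hypothesis E0 : (0 < E)%N.
Variables (f : 'I_N -> 'rV[R]_p -> R) (L gamma : R).
Hypothesis L0 : 0 < L.
Hypothesis fdiff : forall n y, differentiable (f n) y.
Hypothesis fL : forall n y y',
  norm2 (gradient (f n) y - gradient (f n) y') <= L * norm2 (y - y').
Variable Flow : R.
Hypothesis hFlow : forall y, Flow <= average_objective f y.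
Let F := average_objective f.
Let lam := lambda_w W.
Let delta := 1 - lam ^+ 2.
Let eps := gamma * L * E%:R.
Hypothesis lam0 : 0 < lam ^+ 2.
Hypothesis lam1 : lam ^+ 2 < 1.
Hypothesis gamma0 : 0 < gamma.
Hypothesis eps_small : eps <= delta ^+ 2 / 720.
Variable G : nat -> nat -> 'M[R]_(N, p) -> 'M[R]_(N, p).
Variable y0 : 'rV[R]_p.

Let s := chain E W gamma G (ones R N *m y0).
Let x k := st_y (s k).
Let D := grad_mx f.
Let noise k := st_g (s k) - D (x k).
Let h k := mean_row (D (x k)).
Let m k := mean_row (noise k).
Let z k := mean_row (x k).

(** All noise terms of one descent step. The first two are linear in the noise and will be centered;
    the third contributes the variance of the averaged noise. *)
Definition martingale_part k : R :=
  - gamma * dot (mean_row (D (ones R N *m z k))) (m k)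
  + L * gamma ^+ 2 * dot (h k) (m k) + L * gamma ^+ 2 / 2 * sq (m k).

Let nu r := 2 * E%:R * (\sum_(0 <= j < E) sq (noise (r * E + j))) +
  4 * E%:R ^+ 2 * sq (noise (r * E)).

Let mu r := sq (noise (r * E + E)) + sq (noise (r * E)).

(** The weights 2700 and 180 are those of [Sm] and [Sn] in [tracking_sums]. *)
Definition tracking_noise : R :=
  2700 * ((gamma * E%:R) ^+ 2 * \sum_(0 <= r < T) mu r) +
  180 * (gamma ^+ 2 * \sum_(0 <= r < T) nu r).

Let w0 := sq (dev (st_v (s 0%N))).
Let Y r := sq (dev (x (r * E))).
Let V r := sq (dev (st_v (s (r * E)))).
Let Z r := (gamma * E%:R) ^+ 2 * V r + 2 * (gamma * E%:R) ^+ 2 * N%:R * sq (h (r * E))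
  + gamma ^+ 2 * nu r.

Let delta0 : 0 < delta. Proof. by rewrite subr_gt0. Qed.

Let delta1 : delta <= 1. Proof. by rewrite lerBlDr lerDl ltW. Qed.

Let eps0 : 0 < eps. Proof. by rewrite !mulr_gt0// ltr0n. Qed.

Let x_local r q : (0 < q <= E)%N ->
  x (r * E + q) = W *m x (r * E + 0) - (gamma * q%:R) *: (W *m st_v (s (r * E))) -
    gamma *: \sum_(0 <= j < q) (st_g (s (r * E + j)) - st_g (s (r * E + 0))).
Proof. by rewrite addn0; exact: chain_x_round. Qed.

Let v_mean r : mean_row (st_v (s (r * E))) = mean_row (st_g (s (r * E + 0))).
Proof. by rewrite addn0; exact: (chain_mean_v _ _ _ _ hW). Qed.

Let D_lip := grad_mx_lip L0 fL.

Let slackE r : round_slack E gamma D (fun q => x (r * E + q))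
  (fun q => st_g (s (r * E + q))) (st_v (s (r * E))) = Z r.
Proof. by rewrite /round_slack addn0. Qed.

Let consensus_rec r : Y r.+1 <= (1 - delta / 2) * Y r +
  2 / delta * (41 / 10 * Z r + 36 * eps ^+ 2 * Y r).
Proof.
have := round_consensus_contract N0 hW E0 lam0 lam1 gamma0 L0 eps_small D_lip
  (x_local r) (v_mean r).
by rewrite slackE addn0 /Y mulSn [(E + _)%N]addnC.
Qed.

Let tracking_rec r : V r.+1 <= (1 - delta / 2) * V r +
  2 / delta * (162 / 10 * L ^+ 2 * (Y r + Z r) + 4 * mu r).
Proof.
have := round_tracking_contract N0 hW E0 lam0 lam1 gamma0 L0 eps_small D_lip
  (x_local r) (v_mean r).
rewrite slackE addn0 /V mulSn [(E + _)%N]addnC.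
by rewrite (@chain_v_round _ _ _ _ W gamma G (ones R N *m y0) r E)// E0 leqnn.
Qed.

Let nu0 r : 0 <= nu r.
Proof.
have H1 := mulr_ge0 (ler0n R E) (sumr_ge0 _ (fun j _ => sq_ge0 _) :
  0 <= \sum_(0 <= j < E) sq (noise (r * E + j))).
by have := mulr_ge0 (sqr_ge0 E%:R) (sq_ge0 (noise (r * E))); rewrite /nu; lra.
Qed.

Let mu0 r : 0 <= mu r. Proof. by rewrite addr_ge0 ?sq_ge0. Qed.

Let Z0 r : 0 <= Z r.
Proof. by rewrite -slackE; exact: round_slack_ge0. Qed.

Let c0 : 0 <= L ^+ 2 / N%:R. Proof. by rewrite divr_ge0// sqr_ge0. Qed.

Let Lgamma : L * gamma <= 1 / 100.
Proof.
have d2 : delta ^+ 2 <= 1 by rewrite expr_le1// ltW.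
have : L * gamma <= eps.
  by rewrite /eps [gamma * L]mulrC -[leLHS]mulr1 ler_wpM2l ?ler1n// mulr_ge0// ltW.
by move: eps_small d2; lra.
Qed.

Let local_descent r q : (q < E)%N ->
  F (z (r * E + q).+1) <= F (z (r * E + q))
    - gamma * (33 / 100 * sq (h (r * E)) - L ^+ 2 / N%:R * (91 / 10 * Y r + 122 / 10 * Z r))
    + martingale_part (r * E + q).
Proof.
move=> qE; set k := (r * E + q)%N.
have zS : z k.+1 = z k - gamma *: (h k + m k).
  by rewrite /z /x (chain_mean_x _ _ _ _ hW) /h /m -mean_rowD subrKC.
apply: le_trans (descent_step N0 L0 fdiff fL gamma0 zS) _.
rewrite -/F -/D -/(h k) -/(z k) -/(martingale_part k) lerD2r.
have := round_gradient N0 hW E0 lam0 lam1 gamma0 L0 eps_small D_lip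
  (x_local r) (v_mean r) (ltnW qE).
have := round_consensus N0 hW E0 lam0 lam1 gamma0 L0 eps_small D_lip
  (x_local r) (v_mean r) (ltnW qE).
rewrite slackE addn0 -/k -/(Y r) -/(h k) -/(h (r * E)) => Hc Hg.
have a1 := ler_wpM2l (ltW gamma0) Hg.
have a2 := ler_wpM2l (mulr_ge0 (ltW gamma0) c0) Hc.
have a3 := ler_wpM2l (mulr_ge0 (ltW gamma0) (sq_ge0 (h k))) Lgamma.
have a4 := mulr_ge0 (mulr_ge0 (ltW gamma0) c0) (Z0 r).
have a5 := mulr_ge0 (mulr_ge0 (ltW gamma0) c0) (sq_ge0 _ : 0 <= Y r).
exact: (local_descent_arith _ a1 a2 a3 a4 a5).
Qed.

Let descent_sum : F (z (T * E)) <= F (z 0%N)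
  - gamma * E%:R * (33 / 100 * (\sum_(0 <= r < T) sq (h (r * E))) -
      L ^+ 2 / N%:R * (91 / 10 * (\sum_(0 <= r < T) Y r) + 122 / 10 * (\sum_(0 <= r < T) Z r)))
  + \sum_(0 <= r < T) \sum_(0 <= q < E) martingale_part (r * E + q).
Proof.
elim: T => [|t IH]; first by rewrite !big_geq// mul0n; lra.
rewrite !big_nat_recr//= mulSn [(E + _)%N]addnC.
have round q : (q <= E)%N -> F (z (t * E + q)) <= F (z (t * E))
    - gamma * q%:R * (33 / 100 * sq (h (t * E)) -
        L ^+ 2 / N%:R * (91 / 10 * Y t + 122 / 10 * Z t))
    + \sum_(0 <= j < q) martingale_part (t * E + j).
  elim: q => [_|q IHq qE]; first by rewrite big_geq// addn0; lra.
  rewrite addnS big_nat_recr//= -[q.+1]addn1 natrD.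
  have := local_descent t qE; have := IHq (ltnW qE); lra.
by have := round E (leqnn E); move: IH; lra.
Qed.

Lemma pathwise_bound :
  gamma * E%:R / 4 * \sum_(0 <= r < T) sq (h (r * E)) <=
  F (mean_row (ones R N *m y0)) - Flow
  + (\sum_(0 <= r < T) \sum_(0 <= q < E) martingale_part (r * E + q))
  + gamma * E%:R * (L ^+ 2 / N%:R) *
    ((350 * ((gamma * E%:R) ^+ 2 * w0) + tracking_noise) / delta ^+ 4).
Proof.
have := descent_sum; have := hFlow (z (T * E)); rewrite -/F.
pose Sy := \sum_(0 <= r < T) Y r.
pose Sw := (gamma * E%:R) ^+ 2 * \sum_(0 <= r < T) V r.
pose H := \sum_(0 <= r < T) sq (h (r * E)).
pose Sk := (gamma * E%:R) ^+ 2 * N%:R * H.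
pose Sn := gamma ^+ 2 * \sum_(0 <= r < T) nu r.
pose Sm := (gamma * E%:R) ^+ 2 * \sum_(0 <= r < T) mu r.
have SZ : \sum_(0 <= r < T) Z r = Sw + 2 * Sk + Sn.
  rewrite /Sw /Sk /Sn /H !mulr_sumr -!big_split; apply: eq_bigr => r _ /=.
  by rewrite /Z; ring.
have H0 : 0 <= H by apply: sumr_ge0 => r _; exact: sq_ge0.
have a0 : 0 <= (gamma * E%:R) ^+ 2 by exact: sqr_ge0.
have Sy0 : 0 <= Sy by apply: sumr_ge0 => r _; exact: sq_ge0.
have Sw0 : 0 <= Sw by apply: mulr_ge0 => //; apply: sumr_ge0 => r _; exact: sq_ge0.
have Sk0 : 0 <= Sk by apply: mulr_ge0 => //; apply: mulr_ge0.
have Sn0 : 0 <= Sn by apply: mulr_ge0; [exact: sqr_ge0|apply: sumr_ge0].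
have Sm0 : 0 <= Sm by apply: mulr_ge0 => //; apply: sumr_ge0.
have Hy : delta ^+ 2 * Sy <= 4 * (41 / 10 * (Sw + 2 * Sk + Sn) + 36 * eps ^+ 2 * Sy).
  have := contraction_sum (T := T) delta0 (fun r => sq_ge0 _ : 0 <= Y r)
    (fun r _ => consensus_rec r).
  (* All agents start at [y0], so the initial consensus error vanishes and only [w0] survives as
     initial data. *)
  by rewrite {2}/Y mul0n [dev _](dev_ones N0) sq0 mulr0 add0r big_split /= -!mulr_sumr SZ.
have Hw : delta ^+ 2 * Sw <= 2 * delta * ((gamma * E%:R) ^+ 2 * w0) +
    4 * (162 / 10 * eps ^+ 2 * (Sy + (Sw + 2 * Sk + Sn)) + 4 * Sm).
  have := contraction_sum (T := T) delta0 (fun r => sq_ge0 _ : 0 <= V r)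
    (fun r _ => tracking_rec r).
  rewrite {2}/V mul0n -/w0 big_split /= -!mulr_sumr big_split /= SZ => HV.
  have := ler_wpM2l a0 HV; rewrite /Sw /Sm /eps -/Sy; lra.
have := tracking_sums delta0 delta1 eps0 eps_small Sy0 Sw0 Sk0 Sn0 Sm0
  (mulr_ge0 a0 (sq_ge0 _) : 0 <= (gamma * E%:R) ^+ 2 * w0) Hy Hw.
rewrite -SZ -/Sy -/H => Hs Hlow Hd.
have gE0 : 0 <= gamma * E%:R by rewrite mulr_ge0// ltW.
(* This product is [(eps / delta)^2 H], and [eps <= delta^2 / 720 <= delta / 720]. *)
have Hk : L ^+ 2 / N%:R * (Sk / delta ^+ 2) <= (1 / 720) ^+ 2 * H.
  have -> : L ^+ 2 / N%:R * (Sk / delta ^+ 2) = (eps / delta) ^+ 2 * H.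
    by rewrite /Sk /eps; field; rewrite pnatr_eq0 -lt0n N0 lt0r_neq0.
  apply: ler_wpM2r => //.
  have ed : eps / delta <= 1 / 720.
    rewrite ler_pdivrMr//; apply: le_trans eps_small _.
    have := ler_wpM2l (ltW delta0) delta1; rewrite expr2; move: (delta * delta).
    move=> dd; lra.
  have ed0 : 0 <= eps / delta by apply: divr_ge0; apply: ltW.
  by rewrite ler_sqr// nnegrE; lra.
have Hgk := ler_wpM2l gE0 Hk.
have Hgc := ler_wpM2l (mulr_ge0 gE0 c0) Hs.
have gH := mulr_ge0 gE0 H0.
have -> : 350 * ((gamma * E%:R) ^+ 2 * w0) + tracking_noise =
  350 * ((gamma * E%:R) ^+ 2 * w0) + 2700 * Sm + 180 * Sn.
  by rewrite /tracking_noise addrA.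
exact: (pathwise_arith Hlow Hd Hgc Hgk gH).
Qed.

End pathwise.

(** * Stochastic gradients along the run *)

Lemma step_size_small (R : realType) (lam gamma L e n : R) :
  0 <= lam -> lam ^+ 2 < 1 -> 0 < gamma -> 0 < L -> 1 <= e -> 1 <= n ->
  gamma <= (1 - lam ^+ 2) / (3600 * e * n * L) ->
  gamma <= 3 * (1 - lam ^+ 2) ^+ 2 / (320 * (1 + 7 * lam ^+ 2) * (1 + lam ^+ 2) *
    (1 + 8 * (e - 1) * lam) * n * L) ->
  gamma * L * e <= (1 - lam ^+ 2) ^+ 2 / 720.
Proof.
move=> lam0; have := sqr_ge0 lam; set s := lam ^+ 2 => s0 s1 g0 L0 e1 n1.
set delta := 1 - s => H3 H5.
have d0 : 0 < delta by rewrite subr_gt0.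
have e0 : 0 < e by apply: lt_le_trans e1.
have n0 : 0 < n by apply: lt_le_trans n1.
have x0 : 0 < gamma * L * e by rewrite !mulr_gt0.
have xn : gamma * L * e <= gamma * L * e * n by rewrite ler_peMr// ltW.
(* For [lam ^+ 2 < 1 / 2], [1 - lam ^+ 2] and its square are comparable; otherwise
   [1 + 8 (e - 1) lam] dominates [e]. *)
have [s2|s2] := ltP s (1 / 2).
  have : gamma * L * e * n * 3600 <= delta.
    have enL : 0 < e * n * L by rewrite !mulr_gt0.
    have den : 0 < 3600 * e * n * L by lra.
    move: H3; rewrite (ler_pdivlMr _ _ den).
    by have -> : gamma * (3600 * e * n * L) = gamma * L * e * n * 3600 by ring.
  have dd : delta / 2 <= delta ^+ 2.
    by rewrite expr2 ler_wpM2l ?(ltW d0)// /delta; lra.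
  lra.
have lam8 : 1 / 8 <= lam.
  rewrite leNgt; apply/negP => lam8; have : s < (1 / 8) ^+ 2 by rewrite ltr_pXn2r// nnegrE; lra.
  lra.
have c1 : e <= 1 + 8 * (e - 1) * lam.
  have : (e - 1) * (1 / 8) <= (e - 1) * lam by rewrite ler_wpM2l ?subr_ge0.
  lra.
have c0 : 0 < 1 + 8 * (e - 1) * lam by apply: lt_le_trans c1.
(* At [s = 1/2] the product is [(9/2) (3/2) = 27/4], and [320 * (27/4) / 3 = 720] is the origin of
   that constant. *)
have k1 : 27 / 4 <= (1 + 7 * s) * (1 + s).
  have : 0 <= (s - 1 / 2) * (s - 1 / 2) by exact: sqr_ge0.
  lra.
have k0 : 0 < (1 + 7 * s) * (1 + s) by apply: lt_le_trans k1; lra.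
set c := 1 + 8 * (e - 1) * lam in c1 c0 H5 *.
have m1 : 27 / 4 * e <= (1 + 7 * s) * (1 + s) * c by apply: ler_pM => //; lra.
have kcnL : 0 < (1 + 7 * s) * (1 + s) * c * n * L by rewrite !mulr_gt0//; lra.
have den : 0 < 320 * (1 + 7 * s) * (1 + s) * c * n * L by lra.
move: H5; rewrite (ler_pdivlMr _ _ den).
have m0 : 0 <= gamma * L * n by rewrite !mulr_ge0// ltW.
by have := ler_wpM2l m0 m1; lra.
Qed.

Section entrywise.
Context (R : realType) (T : Type) (Q : (T -> R) -> Prop).
Hypothesis Qadd : forall f g, Q f -> Q g -> Q (fun w => f w + g w).
Hypothesis Qscale : forall a f, Q f -> Q (fun w => a * f w).
Hypothesis Qcst : forall c, Q (fun=> c).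

(** Abstract in [Q], so that the same closure lemmas serve measurability and square
    integrability. *)
Definition entrywise m n (A : T -> 'M[R]_(m, n)) : Prop := forall i j, Q (fun w => A w i j).

Lemma entrywise_cst m n (A : 'M[R]_(m, n)) : entrywise (fun=> A).
Proof. by move=> i j; exact: Qcst. Qed.

Lemma entrywise_add m n (A A' : T -> 'M[R]_(m, n)) :
  entrywise A -> entrywise A' -> entrywise (fun w => A w + A' w).
Proof.
move=> hA hA' i j; rewrite (_ : (fun _ => _) = (fun w => A w i j + A' w i j)).
  exact: Qadd.
by apply/funext => w; rewrite mxE.
Qed.

Lemma entrywise_scale m n a (A : T -> 'M[R]_(m, n)) :
  entrywise A -> entrywise (fun w => a *: A w).
Proof.
move=> hA i j; rewrite (_ : (fun _ => _) = (fun w => a * A w i j)); first exact: Qscale.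
by apply/funext => w; rewrite mxE.
Qed.

Lemma entrywise_sub m n (A A' : T -> 'M[R]_(m, n)) :
  entrywise A -> entrywise A' -> entrywise (fun w => A w - A' w).
Proof.
move=> hA /(entrywise_scale (-1)) hA'.
rewrite (_ : (fun _ => _) = (fun w => A w + (-1) *: A' w)); first exact: entrywise_add.
by apply/funext => w; rewrite scaleN1r.
Qed.

Lemma entrywise_mul k m n (M : 'M[R]_(k, m)) (A : T -> 'M[R]_(m, n)) :
  entrywise A -> entrywise (fun w => M *m A w).
Proof.
move=> hA i j; rewrite (_ : (fun _ => _) = (fun w => \sum_h M i h * A w h j)); last first.
  by apply/funext => w; rewrite mxE.
elim: (index_enum _) => [|h s IH].
  by under [X in Q X]eq_fun do rewrite big_nil.
by under [X in Q X]eq_fun do rewrite big_cons; apply: Qadd => //; exact: Qscale.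
Qed.

Lemma entrywise_mean_row m n (A : T -> 'M[R]_(m, n)) :
  entrywise A -> entrywise (fun w => mean_row (A w)).
Proof.
move=> hA; rewrite (_ : (fun _ => _) = (fun w => m%:R^-1 *: ((ones R m)^T *m A w))).
  by apply: entrywise_scale; exact: entrywise_mul.
by apply/funext => w; rewrite mean_rowE.
Qed.

Lemma entrywise_dev m n (A : T -> 'M[R]_(m, n)) :
  entrywise A -> entrywise (fun w => dev (A w)).
Proof.
by move=> hA; apply: entrywise_sub => //; apply: entrywise_mul; exact: entrywise_mean_row.
Qed.

End entrywise.

Definition mx_measurable (R : realType) (d : measure_display) (T : measurableType d) m n
  (A : T -> 'M[R]_(m, n)) : Prop := entrywise (measurable_fun [set: T]) A.

Definition mx_L2 (R : realType) (d : measure_display) (T : measurableType d)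
  (P : probability T R) m n (A : T -> 'M[R]_(m, n)) : Prop := entrywise (L2 P) A.

Section chain_measurable.
Context (R : realType) (N p b E : nat) (W : 'M[R]_N) (gamma : R).
Context (dX dT : measure_display) (X : 'I_N -> measurableType dX) (T : measurableType dT).
Variable l : forall n, 'rV[R]_p -> X n -> R.
Arguments l : clear implicits.
Hypothesis ldiff : forall n xi y, differentiable (fun y' => l n y' xi) y.
Hypothesis lmeas : forall n y, measurable_fun setT (l n y).
Arguments ldiff : clear implicits.
Arguments lmeas : clear implicits.
Variable f : 'I_N -> 'rV[R]_p -> R.
Hypothesis fdiff : forall n y, differentiable (f n) y.
Variable B : forall n, nat -> nat -> T -> b.-tuple (X n).
Variable Y0 : 'M[R]_(N, p).

Let madd (g h : T -> R) : measurable_fun setT g -> measurable_fun setT h ->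
  measurable_fun setT (fun w => g w + h w).
Proof. exact: measurable_funD. Qed.

Let mscale (a : R) (g : T -> R) : measurable_fun setT g ->
  measurable_fun setT (fun w => a * g w).
Proof. by move=> mg; exact: measurable_funM. Qed.

Let mcst (c : R) : measurable_fun [set: T] (fun=> c).
Proof. exact: measurable_cst. Qed.

Lemma mx_measurable_mul k m n (M : 'M[R]_(k, m)) (A : T -> 'M[R]_(m, n)) :
  mx_measurable A -> mx_measurable (fun w => M *m A w).
Proof. exact: entrywise_mul. Qed.

Lemma mx_measurable_mean_row m n (A : T -> 'M[R]_(m, n)) :
  mx_measurable A -> mx_measurable (fun w => mean_row (A w)).
Proof. exact: entrywise_mean_row. Qed.

Let row_measurable n (A : T -> 'M[R]_(N, p)) : mx_measurable A ->
  forall j, measurable_fun setT (fun w => row n (A w) ord0 j).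
Proof. by move=> mA j; under eq_fun do rewrite mxE; exact: mA. Qed.

Lemma grad_mx_measurable (A : T -> 'M[R]_(N, p)) :
  mx_measurable A -> mx_measurable (fun w => grad_mx f (A w)).
Proof.
move=> mA i j; under eq_fun do rewrite mxE.
exact: (@measurable_gradient _ _ _ _ _ T (fun y _ => f i y) _ _ _ (row_measurable i mA) id).
Qed.

Lemma stacked_grad_measurable (A : T -> 'M[R]_(N, p)) r q :
  (forall n, measurable_fun setT (B n r q)) -> mx_measurable A ->
  mx_measurable (fun w => stacked_grad l (fun n => B n r q w) (A w)).
Proof.
move=> mB mA i j.
have := measurable_minibatch_grad (ldiff i) (lmeas i) (row_measurable i mA) j (mB i).
by congr (measurable_fun _ _); apply/funext => w; rewrite [RHS]mxE.
Qed.

Let s (w : T) := chain E W gamma (fun r q => stacked_grad l (fun n => B n r q w)) Y0.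

(** The last conjunct records that iterate [k + 1] depends on the batches up to [k] only. The space
    [T] stays arbitrary because it will carry a sigma-algebra coarser than that of [Om]. *)
Lemma chain_measurable k :
  (forall n j, (j <= k)%N -> measurable_fun setT (B n (batch_index E j).1 (batch_index E j).2)) ->
  [/\ mx_measurable (fun w => st_y (s w k)), mx_measurable (fun w => st_v (s w k)),
      mx_measurable (fun w => st_g (s w k)) & mx_measurable (fun w => st_y (s w k.+1))].
Proof.
have yS k' : mx_measurable (fun w => st_y (s w k')) -> mx_measurable (fun w => st_v (s w k')) ->
    mx_measurable (fun w => st_y (s w k'.+1)).
  move=> my mv.
  have ymix (M : 'M[R]_N) :
      mx_measurable (fun w => M *m st_y (s w k') - gamma *: (M *m st_v (s w k'))).
    by apply: entrywise_sub => //; [|apply: entrywise_scale => //]; exact: entrywise_mul.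
  rewrite /s /=; case: (E %| k')%N => /=; first exact: ymix.
  by have := ymix 1%:M; congr mx_measurable; apply/funext => w; rewrite !mul1mx.
elim: k => [|k IH] mB.
  have my : mx_measurable (fun w => st_y (s w 0)) by exact: entrywise_cst.
  have mg : mx_measurable (fun w => st_g (s w 0)).
    by apply: stacked_grad_measurable => // n; exact: (mB n 0%N).
  by split=> //; apply: yS.
have [|my mv mg my'] := IH; first by move=> n j jk; apply: mB; exact: leqW.
have mg' : mx_measurable (fun w => st_g (s w k.+1)).
  have := stacked_grad_measurable (fun n => mB n k.+1 (leqnn _)) my'.
  by congr mx_measurable; apply/funext => w; rewrite /s chain_g.
have mv' : mx_measurable (fun w => st_v (s w k.+1)).
  have vmix (M : 'M[R]_N) :
      mx_measurable (fun w => M *m st_v (s w k) + st_g (s w k.+1) - st_g (s w k)).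
    by apply: entrywise_sub => //; apply: entrywise_add => //; exact: entrywise_mul.
  have := vmix (if (E %| k)%N then W else 1%:M).
  by congr mx_measurable; apply/funext => w; rewrite /s chain_vS; case: ifP; rewrite ?mul1mx.
by split=> //; exact: yS.
Qed.

Lemma chain_y_measurable k :
  (forall n j, (j < k)%N -> measurable_fun setT (B n (batch_index E j).1 (batch_index E j).2)) ->
  mx_measurable (fun w => st_y (s w k)).
Proof.
case: k => [|k] mB; first exact: entrywise_cst.
by have [] := chain_measurable mB.
Qed.

End chain_measurable.

Lemma batch_index_inj E : (0 < E)%N -> injective (batch_index E).
Proof.
move=> E0 [|j] [|k] //= [jk jk']; congr _.+1.
by rewrite (divn_eq j E) (divn_eq k E) jk jk'.
Qed.

Lemma batch_index_drawn E T k : (0 < E)%N -> (k <= T * E)%N -> drawn E T (batch_index E k).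
Proof.
case: k => [|k] E0 kTE //; rewrite /drawn /= ltn_pmod// andbT orbC.
by rewrite ltnW// ltn_divLR.
Qed.

Definition as_mfun (d1 d2 : measure_display) (T1 : measurableType d1) (T2 : measurableType d2)
    (g : T1 -> T2) (mg : measurable_fun setT g) : {mfun T1 >-> T2} :=
  HB.pack g (isMeasurableFun.Build _ _ _ _ _ mg).

(** * The run as a stochastic process *)

Section stochastic_run.
Context (R : realType) (N p b E T : nat).
Hypothesis N0 : (0 < N)%N.
Hypothesis E0 : (0 < E)%N.
Variables (W : 'M[R]_N) (L gamma sigma : R).
Hypothesis L0 : 0 < L.
Context (dX d : measure_display) (X : 'I_N -> measurableType dX).
Context (Om : measurableType d) (P : probability Om R).
Variable l : forall n, 'rV[R]_p -> X n -> R.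
Arguments l : clear implicits.
Hypothesis ldiff : forall n xi y, differentiable (fun y' => l n y' xi) y.
Hypothesis lmeas : forall n y, measurable_fun setT (l n y).
Arguments ldiff : clear implicits.
Arguments lmeas : clear implicits.
Variable f : 'I_N -> 'rV[R]_p -> R.
Hypothesis fdiff : forall n y, differentiable (f n) y.
Hypothesis fL : forall n y y',
  norm2 (gradient (f n) y - gradient (f n) y') <= L * norm2 (y - y').
Variable B : forall n, nat -> nat -> {RV P >-> b.-tuple (X n)}.
Hypothesis hBind : independent_batches E T B.
Hypothesis hBgrad : forall n r q, drawn E T (r, q) ->
  unbiased_bounded_variance P (l n) (f n) sigma (B n r q).
Arguments hBgrad : clear implicits.
Variable Y0 : 'M[R]_(N, p).

Let I : eqType := ('I_N * (nat * nat))%type.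
Let S (i : I) : measurableType _ := b.-tuple (X i.1).
Let batch (i : I) : {RV P >-> S i} := B i.1 i.2.1 i.2.2.

Let idx k := batch_index E k.

(** Batches of the other agents at the same evaluation are included, which later gives orthogonality
    between agents; [undup] provides the duplicate-free list that [mutually_independent] asks
    for. *)
Let others (i : I) : seq I :=
  [seq a <- undup [seq (n, idx j) | n <- enum 'I_N, j <- iota 0 (T * E).+1] | a != i].

(* Conditioning on the sigma-algebra generated by every batch but [i], on [Om]
   itself, avoids encoding the past of the run in a product space. *)
Let Past (i : I) : measurableType _ := g_sigma_algebraType (cylinder batch (others i)).

Let mem_others n j i : (j <= T * E)%N -> (n, idx j) != i -> (n, idx j) \in others i.
Proof.
move=> jT neq; rewrite mem_filter neq mem_undup; apply/allpairsP; exists (n, j).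
by split=> //; rewrite ?mem_enum// mem_iota.
Qed.

Let batch_measurable n j i : (j <= T * E)%N -> (n, idx j) != i ->
  measurable_fun [set: Past i] (batch (n, idx j) : Om -> S (n, idx j)).
Proof. by move=> jT neq; apply: measurable_cylinder; exact: mem_others. Qed.

Let past_measurable i : measurable_fun [set: Om] (id : Om -> Past i).
Proof. by move=> _ A mA; rewrite setTI; exact: (sub_cylinder_measurable mA). Qed.

Let past (i : I) : {RV P >-> Past i} := as_mfun (@past_measurable i).

Let past_indep n k : (k <= T * E)%N -> indep_rv P (past (n, idx k)) (batch (n, idx k)).
Proof.
move=> kT; apply: (indep_cylinder hBind).
  by rewrite /= mem_filter eqxx /= filter_uniq// undup_uniq.
move=> a; rewrite inE => /orP[/eqP->|]; first exact: batch_index_drawn.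
rewrite mem_filter mem_undup => /andP[_ /allpairsP[[n' j] [_ + ->]]].
by rewrite mem_iota ltnS => jT; exact: batch_index_drawn.
Qed.

Let s w := chain E W gamma (fun r q => stacked_grad l (fun n => B n r q w)) Y0.
Let x k w := st_y (s w k).
Let noise k w := st_g (s w k) - grad_mx f (x k w).

(** The iterate uses evaluations [j < k] only, and by injectivity of [batch_index] none of their
    batches is the one excluded from [Past (i, idx k)]. *)
Let x_past i k : (k <= T * E)%N -> mx_measurable (x k : Past (i, idx k) -> _).
Proof.
move=> kT; apply: (chain_y_measurable W gamma ldiff lmeas
  (B := fun n r q => B n r q : Past (i, idx k) -> _)) => n j jk.
apply: (@batch_measurable n j); first exact: leq_trans (ltnW jk) kT.
by apply/eqP => -[_ /(batch_index_inj E0)] jE; rewrite jE ltnn in jk.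
Qed.

Let noise_row i k w : row i (noise k w) =
  minibatch_grad (l i) (row i (x k w)) (batch (i, idx k) w) - gradient (f i) (row i (x k w)).
Proof. by rewrite /noise raddfB /= /s chain_g !rowK. Qed.

Let noise_entry i k w j : noise k w i j =
  (minibatch_grad (l i) (row i (x k w)) (batch (i, idx k) w) -
   gradient (f i) (row i (x k w))) ord0 j.
Proof. by rewrite -noise_row [RHS]mxE. Qed.

Let oracle i k : (k <= T * E)%N ->
  unbiased_bounded_variance P (l i) (f i) sigma (batch (i, idx k)).
Proof.
move=> kT; apply: (hBgrad i (idx k).1 (idx k).2).
by rewrite -surjective_pairing; exact: batch_index_drawn.
Qed.

Let x_row_past i k : (k <= T * E)%N ->
  forall j, measurable_fun [set: Past (i, idx k)] (fun w => row i (x k w) ord0 j).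
Proof. by move=> kT j; under eq_fun do rewrite mxE; exact: x_past. Qed.

Lemma noise_row_variance i k : (k <= T * E)%N ->
  mean_le P (fun w => sq (row i (noise k w))) (sigma ^+ 2 / b%:R).
Proof.
move=> kT; have := noise_variance (ldiff i) (lmeas i) (fdiff i) (@past_indep i k kT)
  (@oracle i k kT) (@x_row_past i k kT).
by congr (mean_le _ _ _); apply/funext => w; rewrite noise_row.
Qed.

Lemma noise_entry_L2 i k j : (k <= T * E)%N -> L2 P (fun w => noise k w i j).
Proof.
move=> kT; have := noise_L2 (ldiff i) (lmeas i) (fdiff i) (@past_indep i k kT)
  (@oracle i k kT) (@x_row_past i k kT) j.
by congr (L2 _ _); apply/funext => w; rewrite noise_entry.
Qed.

Lemma noise_entry_orthogonal i k j (U : Om -> R) : (k <= T * E)%N ->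
  measurable_fun [set: Past (i, idx k)] U -> L2 P U ->
  (\int[P]_w (U w * noise k w i j)%:E = 0)%E.
Proof.
move=> kT mU LU; have := noise_orthogonal (ldiff i) (lmeas i) (fdiff i) (@past_indep i k kT)
  (@oracle i k kT) (@x_row_past i k kT) j mU LU.
by move=> <-; apply: eq_integral => w _; rewrite noise_entry.
Qed.

Lemma mx_L2_sq m n (A : Om -> 'M[R]_(m, n)) : mx_L2 P A -> L1 P (fun w => sq (A w)).
Proof.
move=> LA; rewrite (_ : (fun _ => _) = (fun w => \sum_i \sum_j A w i j ^+ 2)).
  by apply: L1_sum => i; apply: L1_sum => j; case: (LA i j).
by apply/funext => w; rewrite -norm2_sqr.
Qed.

Lemma mx_L2_add m n (A A' : Om -> 'M[R]_(m, n)) :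
  mx_L2 P A -> mx_L2 P A' -> mx_L2 P (fun w => A w + A' w).
Proof. by apply: entrywise_add; exact: L2_add. Qed.

Lemma mx_L2_sub m n (A A' : Om -> 'M[R]_(m, n)) :
  mx_L2 P A -> mx_L2 P A' -> mx_L2 P (fun w => A w - A' w).
Proof. by apply: entrywise_sub; [exact: L2_add|exact: L2_scale]. Qed.

Lemma mx_L2_scale m n a (A : Om -> 'M[R]_(m, n)) : mx_L2 P A -> mx_L2 P (fun w => a *: A w).
Proof. by apply: entrywise_scale; exact: L2_scale. Qed.

Lemma mx_L2_mul k m n (M : 'M[R]_(k, m)) (A : Om -> 'M[R]_(m, n)) :
  mx_L2 P A -> mx_L2 P (fun w => M *m A w).
Proof. by apply: entrywise_mul; [exact: L2_add|exact: L2_scale|exact: L2_cst]. Qed.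

Lemma mx_L2_mean_row m n (A : Om -> 'M[R]_(m, n)) :
  mx_L2 P A -> mx_L2 P (fun w => mean_row (A w)).
Proof. by apply: entrywise_mean_row; [exact: L2_add|exact: L2_scale|exact: L2_cst]. Qed.

(** Lipschitz gradients grow at most linearly, so square integrability passes from the point to the
    gradient. *)
Lemma mx_L2_grad (A : Om -> 'M[R]_(N, p)) :
  mx_L2 P A -> mx_L2 P (fun w => grad_mx f (A w)).
Proof.
move=> LA i j; apply: (L2_dom (g := fun w => 2 * L ^+ 2 * sq (A w) + 2 * sq (grad_mx f 0))).
- by apply: (grad_mx_measurable fdiff) => i' j'; case: (LA i' j').
- move=> w; apply: le_trans (ler_norm2_sqr _ i j) _.
  rewrite -/(sq _) -[X in sq X](subrK (grad_mx f 0)).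
  apply: le_trans (sqD_le2 _ _) _.
  by have := grad_mx_lip L0 fL (A w) 0; rewrite subr0; lra.
- by apply: L1_add; [apply: L1_scale; exact: mx_L2_sq|exact: L1_cst].
Qed.

Let v k w := st_v (s w k).
Let g k w := st_g (s w k).

Let noise_L2' k : (k <= T * E)%N -> mx_L2 P (noise k).
Proof. by move=> kT i j; exact: noise_entry_L2. Qed.

Let g_L2 k : (k <= T * E)%N -> mx_L2 P (x k) -> mx_L2 P (g k).
Proof.
move=> kT Lx; have := mx_L2_add (mx_L2_grad Lx) (noise_L2' kT).
by congr (mx_L2 _ _); apply/funext => w; rewrite /noise subrKC.
Qed.

(** Orthogonality needs square integrable iterates; this is derived along the run from the finite
    noise variance and the linear growth of the gradients. *)
Lemma chain_L2 k : (k <= T * E)%N -> mx_L2 P (x k) /\ mx_L2 P (v k).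
Proof.
elim: k => [|k IH] kT.
  have Lx : mx_L2 P (x 0) by move=> i j; exact: L2_cst.
  by split=> //; exact: (g_L2 kT Lx).
have [Lx Lv] := IH (ltnW kT).
pose M := if (E %| k)%N then W else 1%:M.
have Lx' : mx_L2 P (x k.+1).
  have := mx_L2_sub (mx_L2_mul M Lx) (mx_L2_scale gamma (mx_L2_mul M Lv)).
  by congr (mx_L2 _ _); apply/funext => w; rewrite /M /x /s chain_xS; case: ifP; rewrite ?mul1mx.
split=> //.
have := mx_L2_sub (mx_L2_add (mx_L2_mul M Lv) (g_L2 kT Lx')) (g_L2 (ltnW kT) Lx).
by congr (mx_L2 _ _); apply/funext => w; rewrite /M /v /s chain_vS; case: ifP; rewrite ?mul1mx.
Qed.

Lemma noise_sq_mean k : (k <= T * E)%N ->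
  mean_le P (fun w => sq (noise k w)) (N%:R * (sigma ^+ 2 / b%:R)).
Proof.
move=> kT; have := mean_le_sum (index_enum 'I_N) (fun i => noise_row_variance i kT).
rewrite sumr_const card_ord -(mulr_natl (_ / _) N).
by congr (mean_le _ _ _); apply/funext => w; rewrite [RHS]sq_rows.
Qed.

Lemma mean_row_entry m n (A : 'M[R]_(m, n)) j :
  mean_row A ord0 j = m%:R^-1 * \sum_i A i j.
Proof. by rewrite mxE summxE; congr (_ * _); apply: eq_bigr => i _; rewrite mxE. Qed.

(** Letting [a] take both signs expresses integrability and zero mean through upper bounds alone. *)
Definition centered (h : Om -> R) : Prop := forall a, mean_le P (fun w => a * h w) 0.

Lemma centered_sum (J : Type) (r : seq J) (h : J -> Om -> R) :
  (forall i, centered (h i)) -> centered (fun w => \sum_(i <- r) h i w).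
Proof.
move=> hc a; have := mean_le_sum r (fun i => hc i a); rewrite big1//.
by congr (mean_le _ _ _); apply/funext => w; rewrite mulr_sumr.
Qed.

Lemma centered_noise i k j (U : Om -> R) : (k <= T * E)%N ->
  measurable_fun [set: Past (i, idx k)] U -> L2 P U -> centered (fun w => U w * noise k w i j).
Proof.
move=> kT mU LU a; apply: mean_le0; last exact: noise_entry_orthogonal.
exact: L2_L1_mul LU (noise_entry_L2 i j kT).
Qed.

Lemma centered_dot_mean_noise k (Q : Om -> 'rV[R]_p) : (k <= T * E)%N ->
  (forall i, mx_measurable (Q : Past (i, idx k) -> _)) -> mx_L2 P Q ->
  centered (fun w => dot (Q w) (mean_row (noise k w))).
Proof.
move=> kT mQ LQ.
have : centered (fun w => \sum_(j < p) \sum_(i < N) Q w ord0 j * noise k w i j).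
  apply: centered_sum => j; apply: centered_sum => i; apply: centered_noise => //.
  exact: mQ.
move=> hc a; have := hc (a * N%:R^-1).
congr (mean_le _ _ _); apply/funext => w.
rewrite /dot big_ord1 !mulr_sumr; apply: eq_bigr => j _.
rewrite mean_row_entry -mulr_sumr; ring.
Qed.

(** The noise of agent [i'] is measurable in the batches other than that of [i], so cross terms are
    centered; the diagonal leaves [N^-2 * N * sigma^2 / b]. *)
Lemma mean_noise_sq_mean k : (k <= T * E)%N ->
  mean_le P (fun w => sq (mean_row (noise k w))) (sigma ^+ 2 / (N%:R * b%:R)).
Proof.
move=> kT.
have cross : centered (fun w => \sum_(j < p) \sum_(i < N) \sum_(i' < N | i' != i)
    noise k w i' j * noise k w i j).
  apply: centered_sum => j; apply: centered_sum => i.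
  rewrite (_ : (fun _ => _) = (fun w => \sum_(i' <- [seq i' <- index_enum 'I_N | i' != i])
    noise k w i' j * noise k w i j)); last by apply/funext => w; rewrite big_filter.
  have : forall i', i' \in [seq i' <- index_enum 'I_N | i' != i] -> i' != i.
    by move=> i'; rewrite mem_filter => /andP[].
  elim: [seq _ <- _ | _] => [_ a|i' r IH ri].
    rewrite (_ : (fun _ => _) = fun=> 0); first exact: mean_le_cst.
    by apply/funext => w; rewrite big_nil mulr0.
  have IH' := IH (fun i'' i''r => ri i'' (mem_behead (s := i' :: r) i''r)).
  have i'i := ri i' (mem_head _ _).
  have cn : centered (fun w => noise k w i' j * noise k w i j).
    apply: centered_noise => //; last exact: noise_entry_L2.
    have mrow j' : measurable_fun [set: Past (i, idx k)] (fun w => row i' (x k w) ord0 j').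
      by under eq_fun do rewrite mxE; exact: x_past.
    have mb : measurable_fun [set: Past (i, idx k)] (batch (i', idx k) : Om -> S (i', idx k)).
      apply: (@batch_measurable i' k) => //.
      by apply: contra_neq i'i => -[].
    rewrite (_ : (fun _ => _) = (fun w => minibatch_grad (l i') (row i' (x k w))
        (batch (i', idx k) w) ord0 j - gradient (f i') (row i' (x k w)) ord0 j)).
      apply: measurable_funB.
        exact: (measurable_minibatch_grad (ldiff i') (lmeas i') mrow j mb).
      exact: (@measurable_gradient _ _ _ _ _ (Past (i, idx k)) (fun y _ => f i' y) _ _ _ mrow id).
    by apply/funext => w; rewrite noise_entry mxE [X in _ + X]mxE.
  move=> a; have := mean_le_add (cn a) (IH' a); rewrite addr0.
  by congr (mean_le _ _ _); apply/funext => w; rewrite big_cons mulrDr.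
have := mean_le_add (mean_le_scale (sqr_ge0 (N%:R^-1 : R)) (noise_sq_mean kT))
  (cross (N%:R^-1 ^+ 2)).
have -> : N%:R^-1 ^+ 2 * (N%:R * (sigma ^+ 2 / b%:R)) + 0 = sigma ^+ 2 / (N%:R * b%:R).
  by rewrite addr0 invfM expr2 -mulrA mulKf ?pnatr_eq0 -?lt0n// mulrCA.
congr (mean_le _ _ _); apply/funext => w.
rewrite -mulrDr [RHS]/(sq _) [in RHS]norm2_sqr big_ord1 [sq (noise k w)]norm2_sqr.
rewrite exchange_big -big_split mulr_sumr; apply: eq_bigr => j _ /=.
rewrite mean_row_entry exprMn; congr (_ * _).
rewrite [in RHS]expr2 mulr_suml -big_split; apply: eq_bigr => i _ /=.
rewrite [in RHS](bigD1 i)//= mulrDr -expr2; congr (_ + _).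
by rewrite mulr_sumr; apply: eq_bigr => i' _; rewrite mulrC.
Qed.

Section expected_bound.
Variables (y0 : 'rV[R]_p).
Hypothesis Y0E : Y0 = ones R N *m y0.

Let G w r q := stacked_grad l (fun n => B n r q w).

Lemma martingale_part_mean k : (k <= T * E)%N ->
  mean_le P (fun w => martingale_part E W f L gamma (G w) y0 k)
    (L * gamma ^+ 2 / 2 * (sigma ^+ 2 / (N%:R * b%:R))).
Proof.
move=> kT; rewrite /martingale_part -Y0E.
rewrite -[X in mean_le _ _ X]add0r -[X in mean_le _ _ (X + _)]add0r.
have [Lx _] := chain_L2 kT.
have mg i (A : Past (i, idx k) -> 'M[R]_(N, p)) : mx_measurable A ->
    mx_measurable (fun w => mean_row (grad_mx f (A w))).
  by move=> mA; apply: mx_measurable_mean_row; exact: grad_mx_measurable.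
apply: mean_le_add; first apply: mean_le_add.
- apply: (@centered_dot_mean_noise k
    (fun w => mean_row (grad_mx f (ones R N *m mean_row (x k w))))) => //.
    move=> i; apply: mg; apply: mx_measurable_mul; apply: mx_measurable_mean_row.
    exact: x_past.
  by apply: mx_L2_mean_row; apply: mx_L2_grad; apply: mx_L2_mul; exact: mx_L2_mean_row.
- apply: (@centered_dot_mean_noise k (fun w => mean_row (grad_mx f (x k w)))) => //.
    by move=> i; apply: mg; exact: x_past.
  by apply: mx_L2_mean_row; exact: mx_L2_grad.
- apply: mean_le_scale; last exact: mean_noise_sq_mean.
  by rewrite divr_ge0// mulr_ge0 ?sqr_ge0// ltW.
Qed.

Lemma mean_le_sum_nat n (F : nat -> Om -> R) (c : nat -> R) :
  (forall i, (i < n)%N -> mean_le P (F i) (c i)) ->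
  mean_le P (fun w => \sum_(0 <= i < n) F i w) (\sum_(0 <= i < n) c i).
Proof.
move=> Fc; rewrite big_mkord.
have := mean_le_sum (index_enum 'I_n) (fun i : 'I_n => Fc i (ltn_ord i)).
by congr (mean_le _ _ _); apply/funext => w; rewrite big_mkord.
Qed.

Lemma tracking_noise_mean : 0 <= gamma ->
  mean_le P (fun w => tracking_noise E T W f gamma (G w) y0)
    (6480 * (gamma * E%:R) ^+ 2 * T%:R * (N%:R * (sigma ^+ 2 / b%:R))).
Proof.
move=> gamma0; rewrite /tracking_noise -Y0E.
set c := N%:R * (sigma ^+ 2 / b%:R).
have noise_le r j : (r < T)%N -> (j <= E)%N -> mean_le P (fun w => sq (noise (r * E + j) w)) c.
  move=> rT jE; apply: noise_sq_mean; apply: leq_trans (_ : r * E + E <= _)%N.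
    by rewrite leq_add2l.
  by rewrite addnC -mulSn leq_mul2r rT orbT.
(* Each round contributes [2 c] through [mu] and [6 E^2 c] through [nu], and
   [2700 * 2 + 180 * 6 = 6480]. *)
have -> : 6480 * (gamma * E%:R) ^+ 2 * T%:R * c =
    2700 * ((gamma * E%:R) ^+ 2 * \sum_(0 <= r < T) (c + c)) +
    180 * (gamma ^+ 2 * \sum_(0 <= r < T)
      (2 * E%:R * (\sum_(0 <= j < E) c) + 4 * E%:R ^+ 2 * c)).
  rewrite !sumr_const_nat !subn0 -(mulr_natl _ T) -(mulr_natl _ E) -(mulr_natl (_ + _) T).
  by ring.
have noise0 r : (r < T)%N -> mean_le P (fun w => sq (noise (r * E) w)) c.
  by move=> rT; have := noise_le r 0%N rT isT; rewrite addn0.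
apply: mean_le_add; (apply: mean_le_scale; first exact: ler0n);
  (apply: mean_le_scale; first exact: sqr_ge0);
  apply: mean_le_sum_nat => r rT; apply: mean_le_add.
- exact: noise_le.
- exact: noise0.
- apply: mean_le_scale; first exact: mulr_ge0 (ler0n _ _) (ler0n _ _).
  by apply: mean_le_sum_nat => j /ltnW jE; exact: noise_le.
- apply: mean_le_scale; last exact: noise0.
  exact: mulr_ge0 (ler0n _ _) (sqr_ge0 _).
Qed.

Variables (e : rel 'I_N) (Flow phi : R).
Hypothesis hW : mixing_matrix e W.
Hypothesis hFlow : forall y, Flow <= average_objective f y.
Let lam := lambda_w W.
Let delta := 1 - lam ^+ 2.
Hypothesis lam0 : 0 < lam ^+ 2.
Hypothesis lam1 : lam ^+ 2 < 1.
Hypothesis gamma0 : 0 < gamma.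
Hypothesis eps_small : gamma * L * E%:R <= delta ^+ 2 / 720.
Hypothesis hphi : mean_le P (fun w => sq (dev (v 0 w))) phi.

Lemma gradient_sum_mean :
  mean_le P (fun w => \sum_(0 <= r < T) sq (mean_row (grad_mx f (x (r * E) w))))
    (4 / (gamma * E%:R) *
      (average_objective f (mean_row Y0) - Flow
       + T%:R * E%:R * (L * gamma ^+ 2 / 2 * (sigma ^+ 2 / (N%:R * b%:R)))
       + gamma * E%:R * (L ^+ 2 / N%:R / delta ^+ 4) *
         (350 * ((gamma * E%:R) ^+ 2 * phi) +
          6480 * (gamma * E%:R) ^+ 2 * T%:R * (N%:R * (sigma ^+ 2 / b%:R))))).
Proof.
have gE0 : 0 < gamma * E%:R by rewrite mulr_gt0// ltr0n.
have d0 : 0 < delta by rewrite subr_gt0.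
pose upper w := 4 / (gamma * E%:R) *
  (average_objective f (mean_row Y0) - Flow
   + (\sum_(0 <= r < T) \sum_(0 <= q < E) martingale_part E W f L gamma (G w) y0 (r * E + q))
   + gamma * E%:R * (L ^+ 2 / N%:R / delta ^+ 4) *
     (350 * ((gamma * E%:R) ^+ 2 * sq (dev (v 0 w))) + tracking_noise E T W f gamma (G w) y0)).
apply: (@mean_le_dom _ _ _ _ _ upper).
- rewrite (_ : (fun _ => _) = (fun w => \sum_(r < T) sq (mean_row (grad_mx f (x (r * E) w))))).
    apply: L1_sum => r; apply: mx_L2_sq; apply: mx_L2_mean_row; apply: mx_L2_grad.
    by have [] // := @chain_L2 (r * E); rewrite leq_mul2r (ltnW (ltn_ord r)) orbT.
  by apply/funext => w; rewrite big_mkord.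
- move=> w; have := pathwise_bound T N0 hW E0 L0 fdiff fL hFlow lam0 lam1 gamma0
    eps_small (G w) y0.
  rewrite -Y0E => H.
  rewrite /upper -ler_pdivrMl; last by rewrite divr_gt0.
  have assoc (a c u q : R) : a * (c / q) * u = a * c * (u / q).
    by rewrite -!mulrA; congr (_ * (_ * _)); rewrite mulrC.
  by rewrite invf_div assoc.
apply: mean_le_scale; first by rewrite divr_ge0// ltW.
apply: mean_le_add.
  apply: mean_le_add; first exact: mean_le_cst.
  have -> : T%:R * E%:R * (L * gamma ^+ 2 / 2 * (sigma ^+ 2 / (N%:R * b%:R))) =
      \sum_(0 <= r < T) \sum_(0 <= q < E) (L * gamma ^+ 2 / 2 * (sigma ^+ 2 / (N%:R * b%:R))).
    set c := L * _ / 2 * _; rewrite -mulrA (mulr_natl c) (mulr_natl (c *+ E)).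
    by rewrite !sumr_const_nat !subn0.
  apply: mean_le_sum_nat => r rT; apply: mean_le_sum_nat => q qE.
  apply: martingale_part_mean; apply: leq_trans (_ : r * E + E <= _)%N.
    by rewrite leq_add2l ltnW.
  by rewrite addnC -mulSn leq_mul2r rT orbT.
apply: mean_le_scale.
  by rewrite mulr_ge0 ?(ltW gE0)// divr_ge0 ?divr_ge0 ?sqr_ge0// exprn_ge0// ltW.
apply: mean_le_add; last by apply: tracking_noise_mean; exact: ltW.
apply: mean_le_scale; first exact: ler0n.
by apply: mean_le_scale; first exact: sqr_ge0.
Qed.

End expected_bound.

End stochastic_run.

(** * Assembly of the rate *)

Lemma integral_sum_nat (R : realType) (d : measure_display) (Om : measurableType d)
    (P : probability Om R) n (F : nat -> Om -> R) :
  (forall r, (r < n)%N -> L1 P (F r)) ->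
  (\int[P]_w (\sum_(0 <= r < n) F r w)%:E = \sum_(0 <= r < n) \int[P]_w (F r w)%:E)%E.
Proof.
elim: n => [|n IH] LF.
  by rewrite big_geq//; under eq_integral do rewrite big_geq//; rewrite integral0.
have LS : L1 P (fun w => \sum_(0 <= r < n) F r w).
  rewrite (_ : (fun _ => _) = (fun w => \sum_(r < n) F r w)); last first.
    by apply/funext => w; rewrite big_mkord.
  by apply: L1_sum => r; apply: LF; exact: ltnW (ltn_ord r).
rewrite big_nat_recr//= -(IH (fun r rn => LF r (ltnW rn))).
rewrite -[RHS](integralD_EFin measurableT LS (LF n (ltnSn n))).
by apply: eq_integral => w _; rewrite big_nat_recr.
Qed.

(** The derived constants fit into the claimed ones: [2 <= 40], [4 * 350 = 1400 <= 16 * 111] and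
    [4 * 6480 <= 16 * 2577], together with [1 / n <= 1] and [k >= 1], where [k] stands for
    [(1 + 7 lambda^2)^2]. *)
Lemma final_rate_arith (R : realFieldType) (Gap T E gamma L s2 n b d4 phi k : R) :
  0 < T -> 0 < E -> 0 < gamma -> 0 < L -> 0 <= s2 -> 1 <= n -> 0 < b -> 0 < d4 ->
  0 <= phi -> 1 <= k ->
  T^-1 * (4 / (gamma * E) * (Gap + T * E * (L * gamma ^+ 2 / 2 * (s2 / (n * b)))
    + gamma * E * (L ^+ 2 / n / d4) *
      (350 * ((gamma * E) ^+ 2 * phi) + 6480 * (gamma * E) ^+ 2 * T * (n * (s2 / b))))) <=
  4 * Gap / (gamma * E * T) + 40 * L * gamma * s2 / (n * b) +
    16 * k * E ^+ 2 * L ^+ 2 * gamma ^+ 2 / d4 * (2577 * n * s2 / b + 111 / T * phi).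
Proof.
move=> T0 E0 g0 L0 s0 n1 b0 d0 phi0 k1.
have n0 : 0 < n by apply: lt_le_trans n1.
pose q := (gamma * E * L) ^+ 2 / d4.
pose c := n * s2 / b; pose t := phi / T; pose X := L * gamma * s2 / (n * b).
have q0 : 0 <= q by rewrite divr_ge0 ?sqr_ge0 ?ltW.
have c0 : 0 <= c by apply: divr_ge0; [apply: mulr_ge0 => //|]; exact: ltW.
have t0 : 0 <= t by apply: divr_ge0 => //; exact: ltW.
have X0 : 0 <= X.
  by apply: divr_ge0; apply: mulr_ge0; rewrite ?mulr_ge0//; exact: ltW.
have -> : T^-1 * (4 / (gamma * E) * (Gap + T * E * (L * gamma ^+ 2 / 2 * (s2 / (n * b)))
    + gamma * E * (L ^+ 2 / n / d4) *
      (350 * ((gamma * E) ^+ 2 * phi) + 6480 * (gamma * E) ^+ 2 * T * (n * (s2 / b))))) =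
  4 * Gap / (gamma * E * T) + 2 * X + q / n * (1400 * t + 4 * 6480 * c).
  by rewrite /X /q /t /c; field; rewrite !lt0r_neq0.
have -> : 16 * k * E ^+ 2 * L ^+ 2 * gamma ^+ 2 / d4 * (2577 * n * s2 / b + 111 / T * phi) =
  k * (q * (16 * 2577 * c + 1776 * t)).
  by rewrite /q /t /c; field; rewrite !lt0r_neq0.
have -> : 40 * L * gamma * s2 / (n * b) = 40 * X by rewrite /X !mulrA.
have qn : q / n <= q by rewrite ler_pdivrMr// ler_peMr.
have ct0 : 0 <= 1400 * t + 4 * 6480 * c by lra.
have h1 := ler_wpM2r ct0 qn.
have qt := mulr_ge0 q0 t0; have qc := mulr_ge0 q0 c0.
have h2 : q * (16 * 2577 * c + 1776 * t) <= k * (q * (16 * 2577 * c + 1776 * t)).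
  apply: ler_peMl; last exact: k1.
  by lra.
move: h1 h2; move: (k * _) (q / n * _) => A1 A2 h1 h2.
lra.
Qed.

Theorem theorem1 (R : realType) (N p b E T : nat)
  (hN : (0 < N)%N) (hb : (0 < b)%N) (hE : (1 <= E)%N) (hT : (0 < T)%N)
  (* network *)
  (e : rel 'I_N) (he : undirected_connected e)
  (W : 'M[R]_N) (hW : mixing_matrix e W) (hlam : `|lambda_w W| < 1)
  (* local datasets X n with sampling laws D n, losses l n, objectives f n *)
  (dX : measure_display) (X : 'I_N -> measurableType dX)
  (D : forall n, probability (X n) R)
  (l : forall n, 'rV[R]_p -> X n -> R)
  (hlint : forall n y, (D n).-integrable setT (EFin \o l n y))
  (hldiff : forall n xi y, differentiable (fun y' => l n y' xi) y)
  (f : 'I_N -> 'rV[R]_p -> R)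
  (hf : forall n y, f n y = local_objective (D n) (l n) y)
  (hfdiff : forall n y, differentiable (f n) y)
  (Flow : R) (hFlow : forall y, Flow <= average_objective f y)
  (L : R) (hL : 0 < L)
  (hfL : forall n y y',
     norm2 (gradient (f n) y - gradient (f n) y') <= L * norm2 (y - y'))
  (* random mini-batches and stochastic gradients *)
  (d : measure_display) (Om : measurableType d) (P : probability Om R)
  (B : forall n, nat -> nat -> {RV P >-> b.-tuple (X n)})
  (hBind : independent_batches E T B)
  (sigma : R)
  (hBgrad : forall n r q, drawn E T (r, q) ->
     unbiased_bounded_variance P (l n) (f n) sigma (B n r q))
  (* step size and iterates *)
  (gamma : R) (hgamma0 : 0 < gamma) (hgamma1 : gamma < 1)
  (hgamma : small_step N E L (lambda_w W) gamma)
  (y0 : 'rV[R]_p) :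
  let lam := lambda_w W in
  let Y0 : 'M[R]_(N, p) := \matrix_(n < N) y0 in
  let F := average_objective f in
  let st (r : nat) (w : Om) : lsgt_state R N p :=
    lsgt W gamma E (fun r' q => stacked_grad l (fun n => B n r' q w)) Y0 r in
  let phi_v (r : nat) : \bar R :=
    ('E_P[fun w => (norm2 (st_v (st r w) -
                           ones R N *m mean_row (st_v (st r w))) ^+ 2)%R])%E in
  ((T%:R^-1)%R%:E *
     \sum_(0 <= r < T)
       'E_P[fun w => (norm2 (N%:R^-1 *:
              \sum_(n < N) gradient (f n) (row n (st_y (st r w)))) ^+ 2)%R]
   <= (4 * (F (mean_row Y0) - Flow) / (gamma * E%:R * T%:R)
       + 40 * L * gamma * sigma ^+ 2 / (N%:R * b%:R))%R%:E
      + (16 * (1 + 7 * lam ^+ 2) ^+ 2 * E%:R ^+ 2 * L ^+ 2 * gamma ^+ 2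
           / (1 - lam ^+ 2) ^+ 4)%R%:E
        * ((2577 * N%:R * sigma ^+ 2 / b%:R)%R%:E
           + (111 / T%:R)%R%:E * phi_v 0%N))%E.
Proof.
pose lam := lambda_w W.
pose Y0 : 'M[R]_(N, p) := \matrix_(n < N) y0.
pose F := average_objective f.
pose st r w : lsgt_state R N p :=
  lsgt W gamma E (fun r' q => stacked_grad l (fun n => B n r' q w)) Y0 r.
pose phi_v r : \bar R :=
  ('E_P[fun w => (norm2 (st_v (st r w) - ones R N *m mean_row (st_v (st r w))) ^+ 2)%R])%E.
cbv zeta; rewrite -/lam -/Y0 -/F -[X in (_ * (_ + _ * X))%E]/(phi_v 0%N).
have N1 : 1 <= N%:R :> R by rewrite ler1n.
have E1 : 1 <= E%:R :> R by rewrite ler1n.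
have lam_ge0 : 0 <= lam by exact: max_singular_value_ge0.
have lam1 : lam ^+ 2 < 1 by rewrite expr_lt1//; move: hlam; rewrite ger0_norm.
have [H1 [_ [H3 [_ [H5 _]]]]] := hgamma.
(* With [lambda = 0] condition (i) would read [gamma <= 0]. *)
have lam0 : 0 < lam ^+ 2.
  rewrite lt_neqAle sqr_ge0 andbT eq_sym; apply/eqP => lam20.
  by move: H1; rewrite -/lam lam20 mul0r leNgt hgamma0.
have eps_small := step_size_small lam_ge0 lam1 hgamma0 hL E1 N1 H3 H5.
have lmeas n y : measurable_fun setT (l n y).
  by have /measurable_int/measurable_EFinP := hlint n y.
have Y0E : Y0 = ones R N *m y0.
  by apply/row_matrixP => n; rewrite rowK row_ones.
pose s w k := chain E W gamma (fun r q => stacked_grad l (fun n => B n r q w)) Y0 k.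
have stE r w : st r w = s w (r * E)%N by rewrite /st lsgt_chain.
have [_ Lv] := chain_L2 hE W gamma hL hldiff lmeas hfdiff hfL hBind hBgrad Y0 (leq0n (T * E)).
have Lphi : L1 P (fun w => sq (dev (st_v (s w 0%N)))).
  by apply: mx_L2_sq; apply: entrywise_dev => //; [exact: L2_add|exact: L2_scale|exact: L2_cst].
pose phi := fine (phi_v 0%N).
(* Finiteness of the initial tracking error, from square integrability of [v] at evaluation 0, turns
   the extended-real claim into one over the reals. *)
have phiE : phi_v 0%N = phi%:E.
  rewrite /phi fineK// /phi_v unlock; exact: integrable_fin_num Lphi.
have hphi : mean_le P (fun w => sq (dev (st_v (s w 0%N)))) phi.
  by split=> //; rewrite -phiE /phi_v unlock.
have phi0 : 0 <= phi.
  by rewrite -lee_fin -phiE /phi_v unlock; apply: integral_ge0 => w _; rewrite lee_fin sqr_ge0.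
have [_ bound] := gradient_sum_mean hN hE hL hldiff lmeas hfdiff hfL hBind hBgrad Y0E hW hFlow
  lam0 lam1 hgamma0 eps_small hphi.
rewrite phiE -!EFinM -!EFinD.
have T0 : 0 < T%:R :> R by rewrite ltr0n.
pose h r w := sq (mean_row (grad_mx f (st_y (s w (r * E)%N)))).
have hE' r : (fun w => norm2 (N%:R^-1 *: \sum_(n < N) gradient (f n) (row n (st_y (st r w)))) ^+ 2)
    = h r.
  by apply/funext => w; rewrite stE -mean_grad_mx.
have Lh r : (r < T)%N -> L1 P (h r).
  move=> rT; have rTE : (r * E <= T * E)%N by rewrite leq_mul2r ltnW// orbT.
  have [Lx _] := chain_L2 hE W gamma hL hldiff lmeas hfdiff hfL hBind hBgrad Y0 rTE.
  by apply: mx_L2_sq; apply: mx_L2_mean_row; exact: (mx_L2_grad hL hfdiff hfL Lx).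
have -> : (\sum_(0 <= r < T) 'E_P[fun w => (norm2 (N%:R^-1 *:
      \sum_(n < N) gradient (f n) (row n (st_y (st r w)))) ^+ 2)%R])%E =
    (\int[P]_w (\sum_(0 <= r < T) h r w)%:E)%E.
  rewrite integral_sum_nat//; apply: eq_bigr => r _.
  by rewrite hE' unlock.
have Tinv0 : (0 <= (T%:R^-1)%:E :> \bar R)%E by rewrite lee_fin invr_ge0 ler0n.
apply: le_trans (lee_wpmul2l Tinv0 bound) _.
rewrite -EFinM lee_fin.
apply: final_rate_arith => //.
- by rewrite ltr0n.
- exact: sqr_ge0.
- by rewrite ltr0n.
- by rewrite exprn_gt0// subr_gt0.
- have k1 : 1 <= 1 + 7 * lam ^+ 2 by rewrite lerDl mulr_ge0// sqr_ge0.
  by apply: (le_trans k1); rewrite expr2 ler_peMr// (le_trans ler01 k1).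
Qed.
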